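(* Let $G$ be a Lie group with Lie algebra $\mathfrak{g}$, and let $(H,\pi)$ be a unitary representation of $G$ on a Hilbert space $H$ with inner product $\langle\cdot,\cdot\rangle$ and norm $\|\cdot\|$. Let $X,Y\in\mathfrak{g}$, and put $A=\pi(X)$, $B=\pi(Y)$ and $C=\pi([X,Y])$, where for $R\in\mathfrak{g}$ the (possibly unbounded) operator $\pi(R)$ is the closed skew-adjoint infinitesimal generator of the one-parameter unitary group $t\mapsto\pi(\exp tR)$. Then $$\|Ax\|\,\|Bx\| \geq \frac{1}{2}\,|\langle Cx,x\rangle| \qquad \text{for all } x\in D(A)\cap D(B)\cap D(C),$$ where $D(T)$ denotes the domain of the operator $T$.
   Context: Lie groups are finite-dimensional (with no restriction on the dimension), and a unitary representation $(H,\pi)$ of $G$ is a strongly continuous homomorphism $\pi$ from $G$ into the group of unitary operators on the complex Hilbert space $H$. For $R\in\mathfrak{g}$, $\pi(R)$ denotes the closed skew-adjoint operator given by Stone's theorem such that $\pi(\exp tR)=\exp(t\pi(R))$ for all $t\in\mathbb{R}$. Its domain $D(\pi(R))$ is the set of all $u\in H$ for which $\lim_{t\to0}\frac{1}{t}\left(\pi(\exp tR)u-u\right)$ exists in $H$, and $\pi(R)u$ is that limit. The bracket $[X,Y]$ is the Lie bracket in $\mathfrak{g}$. The elements of $\mathfrak{g}$ are viewed as right-invariant vector fields on $G$, with the bracket convention such that $[\pi(X),\pi(Y)]\subseteq\pi([X,Y])$, where $[\pi(X),\pi(Y)]=\pi(X)\pi(Y)-\pi(Y)\pi(X)$ on its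 natural domain. Changing the sign of the bracket does not affect the inequality. *)

(* Defs.v *)
From HB Require Import structures.
From mathcomp Require Import all_boot all_order all_algebra.
From mathcomp Require Import sesquilinear.
From mathcomp Require Import all_classical all_reals all_analysis.
From mathcomp Require Import complex.

Set Implicit Arguments.
Unset Strict Implicit.
Unset Printing Implicit Defensive.

Import Order.TTheory GRing.Theory Num.Theory.
Import numFieldNormedType.Exports.

Local Open Scope classical_set_scope.
Local Open Scope ring_scope.

(** * Smooth maps between open subsets of R^m and R^p *)

(* [U] is meant to be open; ['D_v f x] only depends on [f] near [x]. *)
Fixpoint Ck_on (R : realType) (m k : nat) (U : set 'rV[R]_m)
    (f : 'rV[R]_m -> R) : Prop :=
  match k with
  | 0 => forall x, U x -> {for x, continuous f}
  | k'.+1 => (forall i x, U x -> derivable f x (delta_mx 0 i)) /\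
             (forall i, Ck_on k' U (fun x => 'D_(delta_mx 0 i) f x))
  end.

Definition smooth_on (R : realType) (m : nat) (U : set 'rV[R]_m)
    (f : 'rV[R]_m -> R) : Prop :=
  forall k, Ck_on k U f.

Definition smooth_map_on (R : realType) (m p : nat) (U : set 'rV[R]_m)
    (F : 'rV[R]_m -> 'rV[R]_p) : Prop :=
  forall j, smooth_on U (fun x => F x 0 j).

(** * Lie groups *)

(* [cmap] and [cinv] are total functions, constrained by [is_chart] only on
   [cdom] and on its image respectively. *)
Record chart (R : realType) (n : nat) (M : topologicalType) := Chart {
  cdom : set M;
  cmap : M -> 'rV[R]_n;
  cinv : 'rV[R]_n -> M }.

Definition cimg (R : realType) (n : nat) (M : topologicalType)
    (c : chart R n M) : set 'rV[R]_n :=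
  cmap c @` cdom c.

Definition is_chart (R : realType) (n : nat) (M : topologicalType)
    (c : chart R n M) : Prop :=
  [/\ open (cdom c), open (cimg c),
      forall p, cdom c p -> cinv c (cmap c p) = p,
      forall p, cdom c p -> {for p, continuous (cmap c)} &
      forall x, cimg c x -> {for x, continuous (cinv c)}].

(* A Lie group of dimension [n]: a group on a Hausdorff smooth manifold with
   smooth multiplication and inversion. Neither connectedness nor second
   countability is assumed. In [mulg_smooth], a pair of points of R^n is
   encoded as a row vector of length n + n. *)
HB.mixin Record isLieGroup (R : realType) (n : nat) G
    of Topological G & Group G := {
  lie_hausdorff : hausdorff_space G;
  atlas : set (chart R n G);
  atlas_chart : forall c, atlas c -> is_chart c;
  atlas_cover : forall g : G, exists2 c, atlas c & cdom c g;
  atlas_smooth : forall c d, atlas c -> atlas d ->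
    smooth_map_on (cmap c @` (cdom c `&` cdom d)) (cmap d \o cinv c);
  mulg_continuous : continuous (fun p : G * G => (p.1 * p.2)%g);
  mulg_smooth : forall a b c, atlas a -> atlas b -> atlas c ->
    smooth_map_on
      [set z : 'rV[R]_(n + n) |
        [/\ cimg a (lsubmx z), cimg b (rsubmx z) &
            cdom c (cinv a (lsubmx z) * cinv b (rsubmx z))%g]]
      (fun z => cmap c (cinv a (lsubmx z) * cinv b (rsubmx z))%g);
  invg_continuous : continuous (fun g : G => (g^-1)%g);
  invg_smooth : forall a c, atlas a -> atlas c ->
    smooth_map_on [set x | cimg a x /\ cdom c ((cinv a x)^-1)%g]
      (fun x => cmap c ((cinv a x)^-1)%g)
}.

#[short(type="lieGroupType")]
HB.structure Definition LieGroup (R : realType) (n : nat) :=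
  {G of Topological G & Group G & isLieGroup R n G}.

Definition smooth (R : realType) (n : nat) (G : lieGroupType R n)
    (f : G -> R) : Prop :=
  forall c : chart R n G, atlas c -> smooth_on (cimg c) (f \o cinv c).

(** * The Lie algebra *)

(* Vector fields are derivations of the algebra of smooth real functions; their
   values on functions that are not smooth are irrelevant. *)
Definition vector_field (R : realType) (n : nat) (G : lieGroupType R n)
    (X : (G -> R) -> G -> R) : Prop :=
  [/\ forall f, smooth f -> smooth (X f),
      forall (a : R) f h, smooth f -> smooth h ->
        forall g, X (fun p => a * f p + h p) g = a * X f g + X h g &
      forall f h, smooth f -> smooth h ->
        forall g, X (fun p => f p * h p) g = X f g * h g + f g * X h g].

Definition right_invariant (R : realType) (n : nat) (G : lieGroupType R n)
    (X : (G -> R) -> G -> R) : Prop :=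
  forall (f : G -> R) (a : G), smooth f ->
    forall g, X (fun p => f (p * a)%g) g = X f (g * a)%g.

Definition lie_algebra (R : realType) (n : nat) (G : lieGroupType R n) :
    set ((G -> R) -> G -> R) :=
  [set X | vector_field X /\ right_invariant X].

(* The sign is the one for which [pi X, pi Y] is contained in pi [X, Y]: for
   right-invariant fields it is opposite to the commutator of derivations,
   because right-invariant fields generate left translations, so that
   X (Y phi) = pi(Y) pi(X) phi for phi g = pi(g) u with u a smooth vector. *)
Definition lie_bracket (R : realType) (n : nat) (G : lieGroupType R n)
    (X Y : (G -> R) -> G -> R) : (G -> R) -> G -> R :=
  fun f g => Y (X f) g - X (Y f) g.

(* [gamma] is the curve t |-> exp (t X): the one-parameter subgroup of [G] whose
   initial velocity is the value of [X] at the identity. For [X] in the Lie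
   algebra it exists and is unique, invariant vector fields being complete. *)
Definition is_exp_curve (R : realType) (n : nat) (G : lieGroupType R n)
    (X : (G -> R) -> G -> R) (gamma : R -> G) : Prop :=
  [/\ continuous gamma,
      forall s t, gamma (s + t) = (gamma s * gamma t)%g &
      forall f, smooth f ->
        is_derive (0 : R) (1 : R) (f \o gamma) (X f 1%g)].

(** * Hilbert spaces and unitary representations *)

(* The inner product is linear in its first argument. The norm takes its values
   in R[i]; these are nonnegative reals, on which the partial order of R[i]
   restricts to the usual order. *)
HB.mixin Record isHilbert (R : realType) H
    of CompleteNormedModule R[i] H := {
  inner : {dot H for Num.conj};
  normE_inner : forall u : H, `|u| ^+ 2 = inner u u
}.

#[short(type="hilbertType")]
HB.structure Definition Hilbert (R : realType) :=
  {H of CompleteNormedModule R[i] H & isHilbert R H}.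

Definition unitary (R : realType) (H : hilbertType R) (T : {linear H -> H}) :
    Prop :=
  (forall u v, inner (T u) (T v) = inner u v) /\ (forall v, exists u, T u = v).

Definition unitary_representation (R : realType) (n : nat)
    (G : lieGroupType R n) (H : hilbertType R) (pi : G -> {linear H -> H}) :
    Prop :=
  [/\ forall g, unitary (pi g),
      forall g h u, pi (g * h)%g u = pi g (pi h u) &
      forall u, continuous (fun g => pi g u)].

(** * Infinitesimal generators *)

(* The graph of the operator pi(X): [generates pi X u v] says that [u] is in
   its domain and is mapped to [v]. *)
Definition generates (R : realType) (n : nat) (G : lieGroupType R n)
    (H : hilbertType R) (pi : G -> {linear H -> H})
    (X : (G -> R) -> G -> R) (u v : H) : Prop :=
  exists2 gamma : R -> G, is_exp_curve X gamma &
    (fun t : R => real_complex R t^-1 *: (pi (gamma t) u - u)) @ 0^' --> v.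

Definition dom_gen (R : realType) (n : nat) (G : lieGroupType R n)
    (H : hilbertType R) (pi : G -> {linear H -> H})
    (X : (G -> R) -> G -> R) : set H :=
  [set u | exists v, generates pi X u v].

Definition gen (R : realType) (n : nat) (G : lieGroupType R n)
    (H : hilbertType R) (pi : G -> {linear H -> H})
    (X : (G -> R) -> G -> R) (u : H) : H :=
  xget 0 [set v | generates pi X u v].

(* Main.v *)
From HB Require Import structures.
Require Import Defs.
From mathcomp Require Import all_boot all_order all_algebra.
From mathcomp Require Import sesquilinear.
From mathcomp Require Import all_classical all_reals all_analysis.
From mathcomp Require Import complex ring lra.

(** For u, x in the three domains, Re<Cu,x> = Re<Au,Bx> - Re<Bu,Ax>; the theorem
    is the case u = w x with a phase w such that w<Cx,x> = |<Cx,x>|, by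
    Cauchy-Schwarz. For smooth vectors x the identity is the commutation relation.
    In general x is not in the domain of the generators of other directions, so
    one smears it: the identity is tested against a bump function rho on G,
    shrinking to the identity, in the spirit of Friedrichs' mollifier lemma.

    The function g |-> Re<u, pi(g)x> is differentiable along the right-invariant
    fields X, Y, [X,Y] (with derivatives given by Au, Bu, Cu), and
    g |-> Re<v, pi(g)x> along the left-invariant fields X', Y' that agree with X, Y
    at 1 (with derivatives given by Ax, Bx). Integrating by parts moves all fields
    onto rho, as operators X^ rho = X rho + div(X) rho; the commutator of X^ and Y^
    is -[X,Y]^, and the error terms (X^ - X'^) rho stay bounded in L^1 and have
    integral 0, because X - X' vanishes at 1, so they vanish in the limit when
    paired with a continuous function.

    No integration theory is used: Lebesgue measure in a chart is replaced by the
    mean over a finite grid, with the mesh going to 0 before the bump shrinks. *)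

Import Order.TTheory GRing.Theory Num.Theory.
Import numFieldNormedType.Exports.

Local Open Scope classical_set_scope.
Local Open Scope ring_scope.

Set Implicit Arguments.
Unset Strict Implicit.
Unset Printing Implicit Defensive.

(** * Differentiability from continuous partial derivatives *)

Local Notation "''e_' i" := (delta_mx 0 i) (at level 8, i at level 2, format "''e_' i").

(** For [u = x] the identity reads [0 = 0]; this is why two vectors are kept apart. The obstacle is
    that [Bu] need not lie in the domain of [A], so [Re<u, pi(g)x>] need not have second derivatives
    along right-invariant fields. The second differentiation is therefore done with a left-invariant
    field, which acts on [x] and turns [<Bu, pi(g)x>] into [<Bu, pi(g)Ax>]; the mismatch of the two
    kinds of fields is the price.

    The two dual images of [rho] both have integral 0, so the continuous factor in front of their
    difference may be diminished by its value at 1. Only its oscillation near 1 then multiplies the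
    mismatch.

    Since [pi(g)] is isometric, all difference quotients converge uniformly in [g]. This uniformity
    replaces differentiability in the other directions.

    The bump is never normalized. Means are taken over the cube of radius [e] that shrinks along
    with it, so the mass of [rho] stays above a constant depending only on the dimension. *)

Lemma derivable_line (R : realType) (V : normedModType R) (f : V -> R) (z v : V)
    (t : R) :
  derivable f (z + t *: v) v ->
  is_derive t (1 : R) (fun s => f (z + s *: v)) ('D_v f (z + t *: v)).
Proof.
move=> df.
have E : (fun h : R => h^-1 *: (f (h *: v + (z + t *: v)) - f (z + t *: v))) =
  (fun h : R => h^-1 *: (f (z + (h *: (1 : R) + t) *: v) - f (z + t *: v))).
  by apply: funext => h; rewrite scalerDl addrCA [h *: 1]mulr1.
by split; rewrite /derivable /derive /= -E.
Qed.

Lemma MVT_line (R : realType) (V : normedModType R) (f : V -> R) (z v : V) :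
  (forall t : R, 0 <= t <= 1 -> derivable f (z + t *: v) v) ->
  exists2 t : R, 0 <= t <= 1 & f (z + v) - f z = 'D_v f (z + t *: v).
Proof.
move=> df.
have [| | |c] := @MVT_segment R (fun s : R => f (z + s *: v))
   (fun s : R => 'D_v f (z + s *: v)) 0 1.
- exact: ler01.
- move=> x; rewrite in_itv /= => /andP[x0 x1].
  by apply: derivable_line; apply: df; rewrite !ltW.
- apply: derivable_within_continuous => x; rewrite in_itv /= => x01.
  by apply: ex_derive; apply: derivable_line; exact: df.
- rewrite in_itv /= => c01; rewrite scale1r scale0r addr0 subr0 mulr1 => E.
  by exists c.
Qed.

Lemma derivable_scale_dir (R : realType) (V : normedModType R) (f : V -> R)
    (z v : V) (a : R) :
  derivable f z v -> is_derive z (a *: v) f (a * 'D_v f z).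
Proof.
move=> df.
have d1 : is_derive (0 : R) (1 : R) (fun s => f (z + s *: v)) ('D_v f z).
  have := @derivable_line R V f z v 0; rewrite scale0r addr0; exact.
have d2 : is_derive (0 : R) (1 : R) (fun s => f (z + (a * s) *: v)) (a * 'D_v f z).
  have h : is_derive (0 : R) (1 : R) ( *%R a) a.
    have := is_deriveM (is_derive_cst a (0 : R) 1) (is_derive_id (0 : R) 1).
    by move=> H; apply: is_derive_eq; rewrite scaler0 addr0 [_ *: 1]mulr1.
  have d1' : is_derive (a * 0) (1 : R) (fun s => f (z + s *: v)) ('D_v f z).
    by rewrite mulr0.
  have := @is_derive1_comp R _ _ _ _ _ d1' h.
  by rewrite mulrC.
have E : (fun h : R => h^-1 *: (f (h *: (a *: v) + z) - f z)) =
  (fun h : R => h^-1 *: (f (z + (a * (h *: 1 + 0)) *: v) - f (z + (a * 0) *: v))).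
  apply: funext => h; have -> : a * (h *: 1 + 0) = h * a.
    by rewrite addr0 [h *: 1]mulr1 mulrC.
  by rewrite mulr0 scale0r addr0 [z + _]addrC scalerA.
by case: d2 => h1 h2; split; rewrite /derivable /derive /= E.
Qed.

Lemma differentiable_eps (R : realType) (V W : normedModType R) (f : V -> W)
    (df : {linear V -> W}) (x : V) :
  continuous df ->
  (forall e : R, 0 < e ->
     \forall h \near (0 : V), `|f (h + x) - f x - df h| <= e * `|h|) ->
  differentiable f x /\ 'd f x = df :> (V -> W).
Proof.
move=> cdf H.
have E : f \o shift x = cst (f x) + df +o_ 0 id.
  apply/eqaddoP => e e0; have := H _ e0.
  by apply: filterS => h; rewrite !fctE /= opprD addrA.
have D := diff_unique cdf E.
by split => //; apply/diff_locallyP; rewrite D.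
Qed.

Section C1.
Variables (R : realType) (p : nat).
Implicit Types (f : 'rV[R]_p -> R) (y z : 'rV[R]_p).

Lemma coord_norm_le (x : 'rV[R]_p) i : `|x 0 i| <= `|x|.
Proof.
rewrite [leRHS]/Num.Def.normr/= mx_normrE.
exact: (le_bigmax _ (fun ij : 'I_1 * 'I_p => `|x ij.1 ij.2|) (0, i)).
Qed.

Lemma norm_rV_le (x : 'rV[R]_p) (b : R) :
  0 <= b -> (forall i, `|x 0 i| <= b) -> `|x| <= b.
Proof.
move=> b0 H; rewrite [leLHS]/Num.Def.normr/= mx_normrE.
by apply: bigmax_le => //= -[i j] _ /=; rewrite ord1; exact: H.
Qed.

Definition grad f y : 'rV[R]_p -> R := fun h => \sum_i h 0 i * 'D_('e_i) f y.

Lemma grad_is_linear f y : linear (grad f y).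
Proof.
move=> a u v; rewrite /grad scaler_sumr -big_split /=; apply: eq_bigr => i _.
by rewrite !mxE mulrDl -scalerAl.
Qed.

HB.instance Definition _ f y :=
  GRing.isLinear.Build R 'rV[R]_p R _ (grad f y) (grad_is_linear f y).

Lemma grad_continuous f y : continuous (grad f y).
Proof.
rewrite /grad; apply: continuous_big => [|i _ x]; first exact: add_continuous.
exact: (cvgM (@coord_continuous R 1 p 0 i x) (cvg_cst ('D_('e_i) f y))).
Qed.

(** Going from [y] to [y + h] one coordinate at a time, the mean value theorem on each leg gives a
    partial derivative at a point near [y]. Replacing it by its value at [y] costs little by
    continuity, and there are [p] legs. *)
Lemma C1_differentiable_aux f y :
  (\forall z \near y, forall i, derivable f z 'e_i) ->
  (forall i, {for y, continuous (fun z => 'D_('e_i) f z)}) ->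
  forall e : R, 0 < e ->
    \forall h \near (0 : 'rV[R]_p), `|f (h + y) - f y - grad f y h| <= e * `|h|.
Proof.
move=> df cf _/posnumP[e].
(* The budget for each of the [p] legs; [p.+1] keeps the denominator nonzero when [p = 0]. *)
have e' : 0 < e%:num / p.+1%:R :> R by rewrite divr_gt0.
have : \forall z \near y, (forall i, derivable f z 'e_i) /\
    forall i, `|'D_('e_i) f z - 'D_('e_i) f y| <= e%:num / p.+1%:R.
  near=> z; split; first by near: z.
  near: z; apply: filter_forall => i.
  have /cvgrPdist_le/(_ _ e') := cf i.
  by apply: filterS => z; rewrite distrC.
move=> /nbhs_ballP[d /= d0 Hd].
near=> h.
have hd : `|h| < d.
  by near: h; exact: (@nbhs0_lt R 'rV[R]_p d d0).
(* The corners of the path: [hk k] has already moved in the first [k] coordinates. *)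
pose hk (k : nat) : 'rV[R]_p := \row_i (if (i < k)%N then h 0 i else 0).
have hkS (k : 'I_p) : hk k.+1 = hk k + h 0 k *: 'e_k.
  apply/rowP => i; rewrite !mxE /= ltnS leq_eqVlt.
  have -> : ((i == k :> nat) = (i == k)) by [].
  case: eqVneq => [->|] /=; first by rewrite ltnn mulr1 add0r.
  by rewrite mulr0 addr0.
have hkn k : `|hk k| <= `|h|.
  apply: norm_rV_le => // i; rewrite mxE; case: ifP => _.
    exact: coord_norm_le.
  by rewrite normr0.
have inball (w : 'rV[R]_p) : `|w| <= `|h| -> ball y d (y + w).
  by move=> wh; rewrite -ball_normE /ball_ /= opprD addNKr normrN (le_lt_trans wh).
have key k : (k <= p)%N ->
    `|f (y + hk k) - f y - \sum_(i < p | (i < k)%N) h 0 i * 'D_('e_i) f y|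
     <= k%:R * (e%:num / p.+1%:R * `|h|).
  elim: k => [|k IH] kp.
    have -> : hk 0%N = 0 by apply/rowP => i; rewrite !mxE.
    by rewrite addr0 subrr big_pred0 // subr0 normr0 mul0r.
  have := IH (ltnW kp); pose o := Ordinal kp.
  have E := hkS o; rewrite /= in E.
  have [t t01] : exists2 t : R, 0 <= t <= 1 &
      f (y + hk k + h 0 o *: 'e_o) - f (y + hk k) =
      'D_(h 0 o *: 'e_o) f (y + hk k + t *: (h 0 o *: 'e_o)).
    apply: MVT_line => t /andP[t0 t1].
    apply: ex_derive; apply: derivable_scale_dir.
    rewrite -addrA; apply: (Hd _ (inball _ _)).1.
    apply: norm_rV_le => // i; rewrite !mxE /=.
    have -> : (i == o) = (i == k :> nat) by [].
    case: ltngtP => //= ik.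
    - by rewrite !mulr0 addr0; exact: coord_norm_le.
    - by rewrite !mulr0 addr0 normr0.
    - rewrite mulr1 add0r normrM ger0_norm //.
      by apply: (le_trans _ (coord_norm_le _ o)); rewrite ler_piMl.
  have inb : ball y d (y + hk k + t *: (h 0 o *: 'e_o)).
    rewrite -addrA; apply: inball.
    move: t01 => /andP[t0 t1].
    apply: norm_rV_le => // i; rewrite !mxE /=.
    have -> : (i == o) = (i == k :> nat) by [].
    case: ltngtP => //= ik.
    - by rewrite !mulr0 addr0; exact: coord_norm_le.
    - by rewrite !mulr0 addr0 normr0.
    - rewrite mulr1 add0r normrM ger0_norm //.
      by apply: (le_trans _ (coord_norm_le _ o)); rewrite ler_piMl.
  have [dz Dz] := Hd _ inb.
  have -> := derive_val (is_derive := derivable_scale_dir (h 0 o) (dz o)).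
  rewrite -addrA -E => Et IHk.
  rewrite (bigD1 o) /=; last by rewrite ltnSn.
  rewrite (eq_bigl (fun i : 'I_p => (i < k)%N)); last first.
    move=> i /=; rewrite ltnS leq_eqVlt -(inj_eq val_inj) /=.
    by case: ltngtP.
  set S := \sum_(_ < _ | _) _ in IHk *.
  have -> : f (y + hk k.+1) - f y - (h 0 o * 'D_'e_o f y + S) =
    (f (y + hk k) - f y - S) +
     h 0 o * ('D_'e_o f (y + hk k + t *: (h 0 o *: 'e_o)) - 'D_'e_o f y).
    by rewrite mulrBr -Et; ring.
  apply: (le_trans (ler_normD _ _)).
  rewrite -[in leRHS]natr1 mulrDl mul1r lerD // normrM [leRHS]mulrC.
  by rewrite ler_pM // coord_norm_le.
have /= := key p (leqnn p).
have -> : hk p = h by apply/rowP => i; rewrite mxE ltn_ord.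
rewrite (eq_bigl xpredT) => [|i]; last by rewrite ltn_ord.
rewrite /grad => K.
rewrite [h + y]addrC.
apply: (le_trans K); rewrite mulrA ler_pM // mulrCA ler_piMr //.
by rewrite ler_pdivrMr ?mul1r ?ler_nat.
Unshelve. all: by end_near. Qed.

Lemma C1_diff f y :
  (\forall z \near y, forall i, derivable f z 'e_i) ->
  (forall i, {for y, continuous (fun z => 'D_('e_i) f z)}) ->
  differentiable f y /\ 'd f y = grad f y :> ('rV[R]_p -> R).
Proof.
move=> df cf.
exact: (@differentiable_eps R 'rV[R]_p R f (grad f y) y (@grad_continuous f y)
  (C1_differentiable_aux df cf)).
Qed.

End C1.

(** * Functions of class C^k *)

Lemma is_derive_comp_rV (R : realType) p (f : 'rV[R]_p -> R) (c : R -> 'rV[R]_p)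
    (t : R) (v : 'rV[R]_p) :
  (forall j, is_derive t (1 : R) (fun s => c s 0 j) (v 0 j)) ->
  differentiable f (c t) -> 'd f (c t) = grad f (c t) :> ('rV[R]_p -> R) ->
  is_derive t (1 : R) (f \o c) (grad f (c t) v).
Proof.
move=> dc df dE.
have c1 : derivable c t 1.
  by apply/derivable_mxP => i j; rewrite ord1; have [] := dc j.
have dcd : differentiable c t by apply/derivable1_diffP.
have Dc : 'd c t 1 = v.
  rewrite -deriveE // derive_mx //; apply/rowP => j; rewrite mxE.
  by have [_ ->] := dc j.
have dfc : differentiable (f \o c) t by exact: differentiable_comp.
split; first exact/derivable1_diffP.
by rewrite deriveE // diff_comp // /= Dc dE.
Qed.

Lemma open_near (T : topologicalType) (U : set T) x :
  open U -> U x -> \forall z \near x, U z.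
Proof. by move=> oU Ux; exact: open_nbhs_nbhs. Qed.

Section Ck.
Variable R : realType.

Lemma cvg_rV (T : Type) (F : set_system T) {FF : Filter F} p
    (f : T -> 'rV[R]_p) (l : 'rV[R]_p) :
  (forall j, f x 0 j @[x --> F] --> l 0 j) -> f @ F --> l.
Proof.
move=> H; apply/cvgrPdist_le => e e0; near=> x.
apply: norm_rV_le => [|i]; first exact: ltW.
rewrite !mxE; move: i; near: x; apply: filter_forall => i.
by have /cvgrPdist_le/(_ _ e0) := H i.
Unshelve. all: by end_near. Qed.

Lemma Ck_on_sub m k (U V : set 'rV[R]_m) f :
  V `<=` U -> Ck_on k U f -> Ck_on k V f.
Proof.
move=> VU; elim: k f => [|k IH] f /=; first by move=> H x /VU; exact: H.
by move=> [H1 H2]; split => [i x /VU|i]; [exact: H1|exact: IH].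
Qed.

Lemma Ck_on_eq m k (U : set 'rV[R]_m) f g : open U ->
  (forall x, U x -> f x = g x) -> Ck_on k U f -> Ck_on k U g.
Proof.
move=> oU; elim: k f g => [|k IH] f g /= fg.
  move=> H x Ux; rewrite /prop_for /continuous_at -fg //.
  apply: (cvg_trans _ (H _ Ux)).
  have N : \forall z \near x, f z = g z.
    by move: (open_near oU Ux); apply: filterS => z /fg.
  exact: (near_eq_cvg N).
have N x : U x -> \forall z \near x, f z = g z.
  by move=> Ux; move: (open_near oU Ux); apply: filterS => z /fg.
move=> [H1 H2]; split => [i x Ux|i].
  exact: near_eq_derivable (N _ Ux) (H1 i x Ux).
apply: IH (H2 i) => x Ux; exact: near_eq_derive (N _ Ux).
Qed.

(** [V] may be any set, because [Ck_on] is a condition on the total function at each point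
    separately and so passes to arbitrary unions. *)
Lemma Ck_on_local m k (U : set 'rV[R]_m) f :
  (forall x, U x -> exists2 V, V x & Ck_on k V f) -> Ck_on k U f.
Proof.
elim: k f => [|k IH] f /= H.
  by move=> x Ux; have [V Vx] := H _ Ux; apply.
split => [i x Ux|i]; first by have [V Vx [+ _]] := H _ Ux; apply.
by apply: IH => x Ux; have [V Vx [_ HV]] := H _ Ux; exists V.
Qed.

(** Continuity of the partial derivatives is stated only at the lowest level of [Ck_on]. Higher up
    it comes from their differentiability, hence the induction. *)
Lemma Ck_on_diff m k (U : set 'rV[R]_m) f x : open U -> Ck_on k.+1 U f -> U x ->
  differentiable f x /\ 'd f x = grad f x :> ('rV[R]_m -> R).
Proof.
move=> oU; elim: k f => [|k IH] f /=.
  move=> [H1 H2] Ux; apply: C1_diff => [|i]; last exact: H2.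
  by move: (open_near oU Ux); apply: filterS => z Uz i; exact: H1.
move=> [H1 H2] Ux; apply: C1_diff => [|i].
  by move: (open_near oU Ux); apply: filterS => z Uz i; exact: H1.
by have [/differentiable_continuous] := IH _ (H2 i) Ux.
Qed.

Lemma Ck_onW m k (U : set 'rV[R]_m) f : open U -> Ck_on k.+1 U f -> Ck_on k U f.
Proof.
move=> oU; elim: k f => [|k IH] f.
  by move=> H x Ux; have [/differentiable_continuous] := Ck_on_diff oU H Ux.
by move=> [H1 H2]; split => // i; apply: IH; exact: H2.
Qed.

Lemma Ck_on_cst m k (U : set 'rV[R]_m) (a : R) : Ck_on k U (fun=> a).
Proof.
elim: k a => [|k IH] a /=; first by move=> x _; exact: cst_continuous.
split => [i x _|i]; first exact: derivable_cst.
have -> : (fun x : 'rV[R]_m => 'D_'e_i (fun=> a) x) = fun=> 0.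
  by apply: funext => x; exact: derive_cst.
exact: IH.
Qed.

Lemma is_derive_coord m (i j : 'I_m) (x : 'rV[R]_m) :
  is_derive x 'e_i (fun x : 'rV[R]_m => x 0 j) ((i == j)%:R : R).
Proof.
split; first exact: diff_derivable (differentiable_coord _ _ _).
have -> : 'D_'e_i (fun x : 'rV[R]_m => x 0 j) x =
    (@fun_of_matrix R 1 m ('D_'e_i id x)) 0 j.
  by rewrite derive_mx ?mxE //; exact: derivable_id.
by rewrite derive_id mxE eqxx /= eq_sym.
Qed.

Lemma Ck_on_coord m k (U : set 'rV[R]_m) j : Ck_on k U (fun x => x 0 j).
Proof.
case: k => [|k] /=; first by move=> x _; exact: coord_continuous.
split => [i x _|i]; first by have [] := is_derive_coord i j x.
have -> : (fun x : 'rV[R]_m => 'D_'e_i (fun x : 'rV[R]_m => x 0 j) x) =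
    fun=> (i == j)%:R.
  by apply: funext => x; have [_ ->] := is_derive_coord i j x.
exact: Ck_on_cst.
Qed.

Lemma Ck_on_add m k (U : set 'rV[R]_m) f g : open U ->
  Ck_on k U f -> Ck_on k U g -> Ck_on k U (fun x => f x + g x).
Proof.
move=> oU; elim: k f g => [|k IH] f g /=.
  by move=> Hf Hg x Ux; apply: continuousD; [exact: Hf|exact: Hg].
move=> [Hf1 Hf2] [Hg1 Hg2]; split => [i x Ux|i].
  by apply: derivableD; [exact: Hf1|exact: Hg1].
apply: (Ck_on_eq oU _ (IH _ _ (Hf2 i) (Hg2 i))) => x Ux.
by rewrite deriveD //; [exact: Hf1|exact: Hg1].
Qed.

Lemma Ck_on_mul m k (U : set 'rV[R]_m) f g : open U ->
  Ck_on k U f -> Ck_on k U g -> Ck_on k U (fun x => f x * g x).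
Proof.
move=> oU; elim: k f g => [|k IH] f g.
  by move=> Hf Hg x Ux; apply: continuousM; [exact: Hf|exact: Hg].
move=> Hf Hg; have [Hf1 Hf2] := Hf; have [Hg1 Hg2] := Hg.
have Hf0 := Ck_onW oU Hf; have Hg0 := Ck_onW oU Hg.
split => [i x Ux|i].
  by apply: derivableM; [exact: Hf1|exact: Hg1].
apply: (Ck_on_eq oU _ (Ck_on_add oU (IH _ _ Hf0 (Hg2 i)) (IH _ _ Hg0 (Hf2 i)))).
by move=> x Ux; rewrite deriveM //; [exact: Hf1|exact: Hg1].
Qed.

Lemma Ck_on_inv m k (U : set 'rV[R]_m) f : open U -> (forall x, U x -> f x != 0) ->
  Ck_on k U f -> Ck_on k U (fun x => (f x)^-1).
Proof.
move=> oU f0; elim: k => [|k IH].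
  by move=> Hf x Ux; apply: continuousV; [exact: f0|exact: Hf].
move=> Hf; have [Hf1 Hf2] := Hf; have H0 := IH (Ck_onW oU Hf).
split => [i x Ux|i]; first by apply: derivableV; [exact: f0|exact: Hf1].
have H := Ck_on_mul oU (Ck_on_cst k U (-1)) (Ck_on_mul oU (Ck_on_mul oU H0 H0) (Hf2 i)).
apply: (Ck_on_eq oU _ H) => x Ux; rewrite deriveV //=; [|exact: f0|exact: Hf1].
by rewrite mulN1r -expr2 -exprVn -scaleNr.
Qed.

Lemma Ck_on_sum m k (U : set 'rV[R]_m) (I : Type) (r : seq I)
    (f : I -> 'rV[R]_m -> R) : open U ->
  (forall i, Ck_on k U (f i)) -> Ck_on k U (fun x => \sum_(i <- r) f i x).
Proof.
move=> oU H; elim: r => [|i r IH].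
  have -> : (fun x => \sum_(i <- [::]) f i x) = fun=> 0.
    by apply: funext => x; rewrite big_nil.
  exact: Ck_on_cst.
have -> : (fun x => \sum_(j <- i :: r) f j x) =
    fun x => f i x + \sum_(j <- r) f j x.
  by apply: funext => x; rewrite big_cons.
exact: Ck_on_add.
Qed.

Lemma derive_comp m p (f : 'rV[R]_p -> R) (F : 'rV[R]_m -> 'rV[R]_p) x i :
  (forall j, derivable (fun x => F x 0 j) x 'e_i) ->
  differentiable f (F x) -> 'd f (F x) = grad f (F x) :> ('rV[R]_p -> R) ->
  is_derive x 'e_i (f \o F)
    (\sum_j 'D_'e_i (fun x => F x 0 j) x * 'D_'e_j f (F x)).
Proof.
move=> dF df dE.
pose c (t : R) := F (t *: 'e_i + x).
have c0 : c 0 = F x by rewrite /c scale0r add0r.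
pose v : 'rV[R]_p := \row_j 'D_'e_i (fun x => F x 0 j) x.
have dc j : is_derive (0 : R) (1 : R) (fun s => c s 0 j) (v 0 j).
  have := @derivable_line R _ (fun x => F x 0 j) x 'e_i 0.
  rewrite scale0r addr0 mxE => /(_ (dF j)); rewrite /c.
  by under eq_fun do rewrite addrC.
have := is_derive_comp_rV dc; rewrite c0 => /(_ f df dE) [h1 h2].
have E : (fun h : R => h^-1 *: ((f \o F) (h *: 'e_i + x) - (f \o F) x)) =
  (fun h : R => h^-1 *: ((f \o c) (h *: (1 : R) + 0) - (f \o c) 0)).
  by apply: funext => h; rewrite /= c0 /c addr0 [h *: 1]mulr1.
have -> : \sum_j 'D_'e_i (fun x => F x 0 j) x * 'D_'e_j f (F x) =
    grad f (F x) v.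
  by apply: eq_bigr => j _; rewrite mxE.
by rewrite -h2; split; rewrite /derivable /derive /= E.
Qed.

Lemma Ck_on_comp m p k (U : set 'rV[R]_p) (V : set 'rV[R]_m)
    (f : 'rV[R]_p -> R) (F : 'rV[R]_m -> 'rV[R]_p) : open U -> open V ->
  (forall x, V x -> U (F x)) ->
  (forall j, Ck_on k V (fun x => F x 0 j)) -> Ck_on k U f ->
  Ck_on k V (fun x => f (F x)).
Proof.
move=> oU oV VU; elim: k f => [|k IH] f HF Hf.
  move=> x Vx; apply: continuous_comp; last exact: Hf (VU _ Vx).
  by apply: (@cvg_rV _ (nbhs x)) => j; exact: HF.
have HF0 j : Ck_on k V (fun x => F x 0 j) by exact: Ck_onW.
have D i x : V x -> is_derive x 'e_i (fun x => f (F x))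
    (\sum_j 'D_'e_i (fun x => F x 0 j) x * 'D_'e_j f (F x)).
  move=> Vx; have [d1 d2] := Ck_on_diff oU Hf (VU _ Vx).
  apply: (derive_comp _ d1 d2) => j; have [H _] := HF j; exact: H.
split => [i x Vx|i]; first by have [] := D i x Vx.
have H : Ck_on k V (fun x => \sum_j
    'D_'e_i (fun x => F x 0 j) x * 'D_'e_j f (F x)).
  apply: Ck_on_sum => // j; apply: Ck_on_mul => //.
    by have [_] := HF j; apply.
  by apply: (IH (fun z => 'D_'e_j f z) HF0); have [_ H2] := Hf; exact: H2.
by apply: (Ck_on_eq oV _ H) => x Vx; have [_ ->] := D i x Vx.
Qed.

End Ck.

(** * The flat function [exp(-1/t)] and its derivatives *)

Section Flat.
Variable R : realType.

(** [flat 0] is Cauchy's function [exp(-1/t)]. The factors [t^-k] give a family whose linear span is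
    closed under derivation, so smoothness becomes an induction over all members at once. *)
Definition flat (k : nat) (t : R) : R :=
  if 0 < t then t^-1 ^+ k * expR (- t^-1) else 0.

Lemma flat_ge0 k t : 0 <= flat k t.
Proof.
rewrite /flat; case: ifP => // t0.
by rewrite mulr_ge0 ?expR_ge0 // exprn_ge0 // invr_ge0 ltW.
Qed.

Lemma flat_gt0 t : 0 < t -> 0 < flat 0 t.
Proof. by move=> t0; rewrite /flat t0 expr0 mul1r expR_gt0. Qed.

Lemma flat_le0 k t : t <= 0 -> flat k t = 0.
Proof. by rewrite /flat leNgt => /negbTE ->. Qed.

(** One term of the exponential series, [u^(k+2) / (k+2)! <= exp u] at [u = 1/t]. The quadratic
    order forces derivative 0 at the origin, and the constant returns in the bound on derivatives of
    the bump. *)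
Lemma flat_sq k t : flat k t <= (k.+2)`!%:R * t ^+ 2.
Proof.
rewrite /flat; case: ifPn => [t0|_]; last by rewrite mulr_ge0 // sqr_ge0.
have u0 : 0 < t^-1 by rewrite invr_gt0.
have := @expR_ge1Dxn R (t^-1) k.+1 (ltW u0).
move=> /(le_trans (ler_wpDl ler01 (lexx _))).
rewrite ler_pdivrMr ?ltr0n ?fact_gt0 // => H.
rewrite expRN ler_pdivrMr ?expR_gt0 //.
have -> : t^-1 ^+ k = t^-1 ^+ k.+2 * t ^+ 2.
  by rewrite -addn2 exprD -mulrA -exprMn mulVf ?gt_eqF // expr1n mulr1.
by rewrite [leRHS]mulrAC ler_pM2r ?exprn_gt0 // [leRHS]mulrC.
Qed.

Lemma is_derive_flat k t :
  is_derive t (1 : R) (flat k) (flat k.+2 t - k%:R * flat k.+1 t).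
Proof.
have [t0|t0|->] := ltgtP t 0.
- rewrite !flat_le0 ?(ltW t0) // mulr0 subr0.
  have N : \forall s \near t, cst 0 s = flat k s.
    move: (open_near (@open_lt R 0) t0); apply: filterS => s s0.
    by rewrite flat_le0 // ltW.
  exact: (near_eq_is_derive N (is_derive_cst (0 : R) t (1 : R))).
- have N : \forall s \near t, s^-1 ^+ k * expR (- s^-1) = flat k s.
    move: (open_near (@open_gt R 0) t0); apply: filterS => s s0.
    by rewrite /flat s0.
  have tn0 : t != 0 by rewrite gt_eqF.
  have dV : is_derive t (1 : R) (fun s : R => s^-1) (- t ^- 2).
    have := is_deriveV tn0 (is_derive_id t (1 : R)).
    by rewrite [_ *: 1]mulr1.
  have dVk : is_derive t (1 : R) (fun s : R => s^-1 ^+ k) (- (k%:R * t^-1 ^+ k.+1)).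
    have := @is_deriveX _ _ (fun s : R => s^-1) k t 1 _ dV.
    have -> : (fun s : R => s^-1) ^+ k = fun s : R => s^-1 ^+ k.
      by apply: funext => s; rewrite exprfctE.
    move=> H; apply: (is_derive_eq H).
    rewrite [_ *: _]mulrN; congr (- _); case: k {N H} => [|k]; first by rewrite !mul0r.
    by rewrite /= -mulrA -exprVn -exprD addn2.
  have dN : is_derive t (1 : R) (fun s : R => - s^-1) (t ^- 2).
    by have := is_deriveN dV; rewrite opprK.
  have dE : is_derive t (1 : R) (fun s : R => expR (- s^-1)) (expR (- t^-1) * t ^- 2).
    exact: (is_derive1_comp (f := expR) (g := fun s : R => - s^-1)
              (is_derive_expR _) dN).
  apply: (near_eq_is_derive N).
  have H := is_deriveM dVk dE; apply: (is_derive_eq H).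
  have key (a e q : R) : a ^+ k * (e * a ^+ 2) + e * - (q * a ^+ k.+1) =
      a ^+ k.+2 * e - q * (a ^+ k.+1 * e) by rewrite !exprS; ring.
  by rewrite /flat t0 -key -exprVn.
- rewrite !flat_le0 // mulr0 subr0.
  (* At the origin the quadratic bound makes the difference quotient at most a constant times
     [|h|]. *)
  have H : (fun h : R => h^-1 *: (flat k (h *: (1 : R) + 0) - flat k 0)) @ 0^' --> (0 : R).
    apply/cvgr0Pnorm_le => e e0; near=> h.
    rewrite addr0 [h *: 1]mulr1 (@flat_le0 k 0) // subr0 normrM normfV.
    rewrite ler_pdivrMl; last first.
      by rewrite normr_gt0; near: h; exact: nbhs_dnbhs_neq.
    rewrite ger0_norm ?flat_ge0 //; apply: (le_trans (flat_sq _ _)).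
    rewrite -[h ^+ 2]ger0_norm ?sqr_ge0 // normrX expr2 mulrCA ler_wpM2l //.
    rewrite -ler_pdivlMl ?ltr0n ?fact_gt0 //.
    near: h; apply: dnbhs0_le.
    by rewrite mulr_gt0 // invr_gt0 ltr0n fact_gt0.
  split; first by apply/cvg_ex; exists 0.
  exact: cvg_lim H.
Unshelve. all: by end_near. Qed.

Lemma flat_continuous k : continuous (flat k).
Proof.
move=> t; have [d _] := is_derive_flat k t.
exact/differentiable_continuous/derivable1_diffP.
Qed.

Lemma is_derive_flat_comp m k (f : 'rV[R]_m -> R) x i :
  derivable f x 'e_i ->
  is_derive x 'e_i (fun y => flat k (f y))
    ((flat k.+2 (f x) - k%:R * flat k.+1 (f x)) * 'D_'e_i f x).
Proof.
move=> df.
have d1 : is_derive (0 : R) (1 : R) (fun s => f (x + s *: 'e_i)) ('D_'e_i f x).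
  by have := @derivable_line R _ f x 'e_i 0; rewrite scale0r addr0; exact.
have d2 := is_derive_flat k (f x).
have : is_derive (0 : R) (1 : R) (fun s => flat k (f (x + s *: 'e_i)))
    ((flat k.+2 (f x) - k%:R * flat k.+1 (f x)) * 'D_'e_i f x).
  apply: (is_derive1_comp (f := flat k) (g := fun s => f (x + s *: 'e_i)) _ d1).
  by rewrite scale0r addr0.
have E : (fun h : R => h^-1 *: (flat k (f (h *: 'e_i + x)) - flat k (f x))) =
  (fun h : R => h^-1 *: (flat k (f (x + (h *: (1 : R) + 0) *: 'e_i))
     - flat k (f (x + 0 *: 'e_i)))).
  by apply: funext => h; rewrite scale0r !addr0 [h *: 1]mulr1 [x + _]addrC.
by move=> [h1 h2]; split; rewrite /derivable /derive /= E.
Qed.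

Lemma Ck_on_flat m j k (U : set 'rV[R]_m) f : open U ->
  Ck_on k U f -> Ck_on k U (fun x => flat j (f x)).
Proof.
move=> oU; elim: k j => [|k IH] j Hf.
  by move=> x Ux; apply: continuous_comp; [exact: Hf|exact: flat_continuous].
have [Hf1 Hf2] := Hf; have Hf0 := Ck_onW oU Hf.
split => [i x Ux|i]; first by have [] := is_derive_flat_comp j (Hf1 i x Ux).
have H := Ck_on_mul oU (Ck_on_add oU (IH j.+2 Hf0)
  (Ck_on_mul oU (Ck_on_cst k U (- j%:R)) (IH j.+1 Hf0))) (Hf2 i).
apply: (Ck_on_eq oU _ H) => x Ux.
by have [_ ->] := is_derive_flat_comp j (Hf1 i x Ux); rewrite mulNr.
Qed.

End Flat.

(** * Means over a grid in a cube *)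

Section Cube.
Variables (R : realType) (n : nat) (p : 'rV[R]_n).

Definition cube (e : R) : set 'rV[R]_n := [set z | forall i, `|z 0 i - p 0 i| <= e].

Lemma cube_compact e : compact (cube e).
Proof.
have -> : cube e = [set z : 'rV[R]_n | forall i,
    [set t | t \in `[p 0 i - e, p 0 i + e]] (z 0 i)].
  by apply/seteqP; split => z H i; have := H i; rewrite /= in_itv /= ler_distl.
apply: (@rV_compact R n (fun i => `[p 0 i - e, p 0 i + e]%classic)) => i.
exact: segment_compact.
Qed.

Lemma cube_norm e z : 0 <= e -> cube e z <-> `|z - p| <= e.
Proof.
move=> e0; split => [H|H i].
  by apply: norm_rV_le => // i; rewrite !mxE; exact: H.
by have := coord_norm_le (z - p) i; rewrite !mxE => /le_trans; apply.
Qed.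

(** Heine's theorem with compactness in near-covering form: what holds near each point for all small
    [d > 0] holds on the whole cube for all small [d]. *)
Lemma cube_unif_cont e (f : 'rV[R]_n -> R) (eta : R) : 0 < eta ->
  (forall z, cube e z -> {for z, continuous f}) ->
  exists2 d : R, 0 < d & forall z z', cube e z -> cube e z' ->
    `|z - z'| <= d -> `|f z - f z'| <= eta.
Proof.
move=> eta0 cf.
have := (@compact_near_coveringP _ (cube e)).1 (@cube_compact e).
move=> /(_ R (0 : R)^'+ (fun d z => forall z', cube e z' -> `|z - z'| <= d ->
   `|f z - f z'| <= eta)) [].
  move=> x Kx; have := cf _ Kx => /cvgrPdist_le/(_ (eta / 2)).
  rewrite divr_gt0 // => /(_ isT)/nbhs_ballP[r /= r0 Hr].
  near=> z d.
  have dr : d <= r / 2 by near: d; apply: nbhs_right_le; rewrite divr_gt0.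
  have bz : `|x - z| < r / 2.
    near: z; apply: (@cvgr_dist_lt _ _ _ (nbhs x) _ id) => //.
    by rewrite divr_gt0.
  move=> z' _ /= zz'.
  have bz' : `|x - z'| < r.
    rewrite -(subrKA z) (le_lt_trans (ler_normD _ _)) // (splitr r).
    by rewrite ltr_leD // (le_trans zz').
  have h1 : `|f x - f z| <= eta / 2.
    apply: Hr; rewrite -ball_normE /ball_ /=; apply: (lt_trans bz).
    by rewrite ltr_pdivrMr // ltr_pMr // ltr1n.
  have h2 : `|f x - f z'| <= eta / 2 by apply: Hr; rewrite -ball_normE.
  by rewrite -(subrKA (f x)) (le_trans (ler_normD _ _)) // (splitr eta) lerD // distrC.
move=> d /= d0 Hd; exists (d / 2); first by rewrite divr_gt0.
move=> z z' Kz; apply: Hd => //=; last by rewrite divr_gt0.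
by rewrite sub0r normrN ger0_norm ?divr_ge0 ?ltW // ltr_pdivrMr // ltr_pMr // ltr1n.
Unshelve. all: by end_near. Qed.

Lemma cube_bounded e (f : 'rV[R]_n -> R) :
  (forall z, cube e z -> {for z, continuous f}) ->
  exists2 C : R, 0 <= C & forall z, cube e z -> `|f z| <= C.
Proof.
move=> cf.
have := (@compact_near_coveringP _ (cube e)).1 (@cube_compact e).
move=> /(_ R (+oo : set_system R) (fun C z => `|f z| <= C)) [].
  move=> x Kx; near=> z C.
  have : `|f x - f z| <= 1.
    by near: z; have /cvgrPdist_le/(_ 1 ltr01) := cf _ Kx.
  have : `|f x| + 1 <= C by near: C; exact: nbhs_pinfty_ge.
  move=> h1 h2; rewrite -(subKr (f x) (f z)) (le_trans (ler_normB _ _)) //.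
  by rewrite (le_trans _ h1) // lerD2l.
move=> M [Mr H]; exists (Num.max 0 (M + 1)); first by rewrite le_max lexx.
move=> z Kz; apply: H => //; by rewrite lt_max ltrDl ltr01 orbT.
Unshelve. all: by end_near. Qed.

End Cube.

Section Grid.
Variables (R : realType) (n : nat) (p : 'rV[R]_n) (e : R).
Hypothesis e0 : 0 < e.

(** The index set is one period of a lattice: the right face of the cube is left out, so that a
    cyclic shift of one index is a permutation of the grid. *)
Definition grid (N : nat) := {ffun 'I_n -> 'I_(N.+1.*2)}.

(* With K = N.+1, the grid points have coordinates p_i + e j / K for -K <= j < K. *)
Definition gpt (N : nat) (k : grid N) : 'rV[R]_n :=
  \row_i (p 0 i + e * (((k i)%:R - N.+1%:R) / N.+1%:R)).

Definition mean (N : nat) (f : 'rV[R]_n -> R) : R :=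
  (\sum_(k : grid N) f (gpt k)) / (#|{: grid N}|)%:R.

Lemma card_grid_gt0 N : 0 < (#|{: grid N}|)%:R :> R.
Proof. by rewrite ltr0n card_ffun !card_ord expn_gt0 doubleS. Qed.

Lemma meanD N f g : mean N (fun z => f z + g z) = mean N f + mean N g.
Proof. by rewrite /mean big_split mulrDl. Qed.

Lemma meanZ N a f : mean N (fun z => a * f z) = a * mean N f.
Proof. by rewrite /mean -mulr_sumr mulrA. Qed.

Lemma gpt_cube N (k : grid N) : cube p e (gpt k).
Proof.
move=> i; rewrite !mxE addrC addKr normrM (ger0_norm (ltW e0)).
rewrite ler_piMr ?(ltW e0) // normrM normfV [in X in _ / X]ger0_norm //.
rewrite ler_pdivrMr ?ltr0n // mul1r ler_distl subrr ler0n /=.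
by rewrite -natrD ler_nat addnn ltnW.
Qed.

Lemma eq_mean N f g : (forall z, cube p e z -> f z = g z) -> mean N f = mean N g.
Proof.
by move=> H; rewrite /mean; congr (_ / _); apply: eq_bigr => k _; apply/H/gpt_cube.
Qed.

Lemma mean_norm_le N f b : (forall z, cube p e z -> `|f z| <= b) -> `|mean N f| <= b.
Proof.
move=> H; rewrite /mean normrM normfV (ger0_norm (ltW (card_grid_gt0 N))).
rewrite ler_pdivrMr ?card_grid_gt0 //; apply: (le_trans (ler_norm_sum _ _ _)).
apply: (@le_trans _ _ (\sum_(k : grid N) b)).
  by apply: ler_sum => k _; apply/H/gpt_cube.
by rewrite sumr_const mulr_natr.
Qed.

(* By the mean value theorem, the derivative is close to a difference quotient of
   step one mesh. The cyclic shift of the i-th index permutes the grid, and where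
   it wraps around, both values of g vanish, so these quotients sum to 0. *)
Lemma mean_derive_le N i (g : 'rV[R]_n -> R) (eta : R) :
  (forall z, cube p e z -> derivable g z 'e_i) ->
  (forall z z', cube p e z -> cube p e z' -> `|z - z'| <= e / N.+1%:R ->
    `|'D_'e_i g z - 'D_'e_i g z'| <= eta) ->
  (forall z, cube p e z -> `|z 0 i - p 0 i| = e -> g z = 0) ->
  `|mean N ('D_'e_i g)| <= eta.
Proof.
move=> dg ug bg.
pose h := e / N.+1%:R; pose d := h *: 'e_i : 'rV[R]_n.
have N0 : 0 < N.+1%:R :> R by rewrite ltr0n.
have h0 : 0 < h by rewrite divr_gt0.
pose s (k : grid N) : grid N := [ffun j => if j == i then ordS (k i) else k j].
pose s' (k : grid N) : grid N := [ffun j => if j == i then ord_pred (k i) else k j].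
have sK : cancel s s'.
  move=> k; apply/ffunP => j; rewrite !ffunE eqxx ordSK.
  by case: eqP => [->|].
have inc (k : grid N) (t : R) : 0 <= t <= 1 -> cube p e (gpt k + t *: d).
  move=> /andP[t0 t1] j; rewrite !mxE /=.
  have [->|ji] := eqVneq j i; last first.
    by rewrite !mulr0 addr0; have := gpt_cube k j; rewrite !mxE.
  have -> : p 0 i + e * (((k i)%:R - N.+1%:R) / N.+1%:R) + t * (h * 1) - p 0 i
      = e * (((k i)%:R + t - N.+1%:R) / N.+1%:R).
    by rewrite /h; field; rewrite gt_eqF.
  rewrite normrM (ger0_norm (ltW e0)) ler_piMr ?(ltW e0) // normrM normfV.
  rewrite [in X in _ / X]ger0_norm // ler_pdivrMr // mul1r ler_distl subrr.
  rewrite addr_ge0 //= -natrD addnn (@le_trans _ _ ((k i)%:R + 1)) ?lerD2l //.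
  by rewrite natr1 ler_nat.
have gs (k : grid N) : g (gpt k + d) = g (gpt (s k)).
  have [kN|kN] := ltnP (k i).+1 N.+1.*2.
    congr g; apply/rowP => j; rewrite !mxE !ffunE /=.
    have [->|ji] := eqVneq j i; last by rewrite mulr0 addr0.
    rewrite mulr1 /= modn_small // -addrA; congr (_ + _).
    by rewrite -[(k i).+1%:R]natr1 /h; field; rewrite gt_eqF.
  have kE : k i = N.*2.+1 :> nat.
    have H (a : nat) : (N.+1.*2 <= a.+1 -> a < N.+1.*2 -> a = N.*2.+1)%N.
      by rewrite doubleS !ltnS => h1 h2; apply/eqP; rewrite eqn_leq h1 h2.
    exact: (H _ kN (ltn_ord _)).
  have B1 : `|(gpt k + d) 0 i - p 0 i| = e.
    have key (a b c : R) : a + b + c - a = b + c by ring.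
    rewrite !mxE !eqxx key.
    have -> : e * (((k i)%:R - N.+1%:R) / N.+1%:R) + h * 1 = e.
      rewrite kE mulr1 /h -[N.*2.+1%:R]natr1 -muln2 natrM -!natr1.
      by field; rewrite natr1 gt_eqF.
    by rewrite ger0_norm // ltW.
  have B2 : `|gpt (s k) 0 i - p 0 i| = e.
    rewrite !mxE !ffunE eqxx addrC addKr /= kE -doubleS modnn sub0r mulNr.
    by rewrite mulfV ?gt_eqF // mulrN1 normrN ger0_norm // ltW.
  have B3 : cube p e (gpt k + d).
    by have := inc k 1; rewrite scale1r ler01 lexx; apply.
  by rewrite (bg _ B3 B1) (bg _ (gpt_cube _) B2).
have gd (k : grid N) :
    `|'D_'e_i g (gpt k) - h^-1 * (g (gpt k + d) - g (gpt k))| <= eta.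
  have [t t01 ->] : exists2 t : R, 0 <= t <= 1 &
      g (gpt k + d) - g (gpt k) = 'D_d g (gpt k + t *: d).
    apply: MVT_line => t t01; apply: ex_derive; apply: derivable_scale_dir.
    exact/dg/inc.
  have [_ ->] := derivable_scale_dir h (dg _ (inc k _ t01)).
  rewrite mulKf ?gt_eqF //; apply: ug; [exact: gpt_cube|exact: inc|].
  rewrite opprD addNKr normrN; apply: norm_rV_le => [|j]; first exact: ltW.
  rewrite !mxE /=; move: t01 => /andP[t0 t1].
  have [ji|ji] := eqVneq j i; last by rewrite !mulr0 normr0 ltW.
  have th0 : 0 <= t * h by apply: mulr_ge0 => //; exact: ltW.
  by rewrite mulr1 ger0_norm //; apply: ler_piMl => //; exact: ltW.
have S0 : \sum_(k : grid N) (g (gpt k + d) - g (gpt k)) = 0.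
  rewrite sumrB; apply/eqP; rewrite subr_eq0; apply/eqP.
  rewrite (eq_bigr (fun k => g (gpt (s k)))) => [|k _]; last exact: gs.
  by rewrite [RHS](reindex_inj (can_inj sK)).
rewrite /mean normrM normfV (ger0_norm (ltW (card_grid_gt0 N))).
rewrite ler_pdivrMr ?card_grid_gt0 //.
have -> : \sum_(k : grid N) 'D_'e_i g (gpt k) = \sum_(k : grid N)
    ('D_'e_i g (gpt k) - h^-1 * (g (gpt k + d) - g (gpt k))).
  by rewrite sumrB -mulr_sumr S0 mulr0 subr0.
apply: (le_trans (ler_norm_sum _ _ _)).
apply: (@le_trans _ _ (\sum_(k : grid N) eta)); first exact: ler_sum.
by rewrite sumr_const mulr_natr.
Qed.

Lemma mean_derive_cvg0 i (g : 'rV[R]_n -> R) :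
  (forall z, cube p e z -> derivable g z 'e_i) ->
  (forall z, cube p e z -> {for z, continuous ('D_'e_i g)}) ->
  (forall z, cube p e z -> `|z 0 i - p 0 i| = e -> g z = 0) ->
  mean N ('D_'e_i g) @[N --> \oo] --> 0.
Proof.
move=> dg cg bg; apply/cvgr0Pnorm_le => eta eta0.
have [d d0 ug] := cube_unif_cont eta0 cg.
near=> N; apply: mean_derive_le => // z z' Kz Kz' zz'.
apply: ug => //; apply: (le_trans zz').
have : e / d <= N%:R by near: N; exact: nbhs_infty_ger.
rewrite ler_pdivrMr // => H; rewrite ler_pdivrMr ?ltr0n // mulrC.
by apply: (le_trans H); rewrite ler_pM2r // ler_nat.
Unshelve. all: by end_near. Qed.

(** A count of grid points in the orthant of the small cube with nonnegative offsets: they are a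
    fraction [(2 M)^-n] of the grid. The count is exact when [M] divides [N.+1], so the bound is
    given for arbitrarily large [N] rather than for all of them. *)
Lemma mean_ge (M : nat) (f : 'rV[R]_n -> R) (c : R) : (0 < M)%N ->
  (forall z, 0 <= f z) -> (forall z, cube p (e / M%:R) z -> c <= f z) -> 0 <= c ->
  forall N0 : nat, exists2 N, (N0 <= N)%N & c / (2 * M%:R) ^+ n <= mean N f.
Proof.
move=> M0 f0 fc c0 N0; pose j := N0.+1.
have jM : (0 < M * j)%N by rewrite muln_gt0 M0.
(* With [N.+1 = M * j], the indices [M * j + a] for [a < j] have offset [e * a / (M * j)], which is
   below [e / M]. *)
exists (M * j).-1.
  by rewrite -ltnS prednK // (leq_trans _ (leq_pmull _ M0)).
set N := (M * j).-1; have NE : N.+1 = (M * j)%N by rewrite /N prednK.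
have lt_idx (a : 'I_j) : (M * j + a < N.+1.*2)%N.
  by rewrite NE -addnn ltn_add2l (leq_trans (ltn_ord a)) // leq_pmull.
pose P := [set Ordinal (lt_idx a) | a in 'I_j]%SET.
have cP : #|P| = j.
  by rewrite card_imset ?card_ord // => a b [] /addnI/val_inj.
rewrite /mean card_ffun !card_ord ler_pdivlMr; last first.
  by rewrite ltr0n expn_gt0 doubleS.
apply: (@le_trans _ _ (\sum_(k : grid N | k \in ffun_on (mem P)) f (gpt k))); last first.
  rewrite [leRHS](bigID [pred k : grid N | k \in ffun_on (mem P)]) /= lerDl.
  by apply: sumr_ge0.
apply: (@le_trans _ _ (\sum_(k : grid N | k \in ffun_on (mem P)) c)); last first.
  apply: ler_sum => k /ffun_onP kP; apply: fc => i.
  have /imsetP[a _ kE] := kP i.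
  rewrite !mxE addrC addKr kE /= NE natrD addrC addKr natrM.
  have M0' : 0 < M%:R :> R by rewrite ltr0n.
  have j0' : 0 < j%:R :> R by rewrite ltr0n.
  rewrite normrM (ger0_norm (ltW e0)) ler_pM2l // ger0_norm ?divr_ge0 ?mulr_ge0 //.
  by rewrite invfM mulrCA ler_piMr ?invr_ge0 // ler_pdivrMr // mul1r ler_nat ltnW.
rewrite sumr_const card_ffun_on cP card_ord -[leRHS]mulr_natr.
have -> : (N.+1.*2 ^ n)%:R = (2 * M%:R) ^+ n * j%:R ^+ n :> R.
  by rewrite -exprMn natrX -muln2 natrM NE natrM; congr (_ ^+ _); ring.
by rewrite mulrA divfK ?natrX // expf_neq0 // mulf_neq0 ?pnatr_eq0 // -lt0n.
Qed.

End Grid.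

(** * Smooth functions on a Lie group *)

Lemma open_preimage_in (T T' : topologicalType) (U : set T) (h : T -> T')
    (W : set T') :
  open U -> (forall x, U x -> {for x, continuous h}) -> open W ->
  open [set x | U x /\ W (h x)].
Proof.
move=> oU ch oW; rewrite openE => x [Ux Wx].
have : nbhs x (h @^-1` W) by apply: (ch _ Ux); exact: open_near.
by move: (open_near oU Ux); apply: filterS2.
Qed.

(** * Partial functions of a function of two row vectors *)

Section Slice.
Variables (R : realType) (m1 m2 : nat).

Lemma derive_slice_l (f : 'rV[R]_(m1 + m2) -> R) x y i :
  (derivable f (row_mx x y) 'e_(lshift m2 i) ->
   derivable (fun x => f (row_mx x y)) x 'e_i) /\
  'D_'e_i (fun x => f (row_mx x y)) x = 'D_'e_(lshift m2 i) f (row_mx x y).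
Proof.
have E : (fun h : R => h^-1 *: (f (row_mx (h *: 'e_i + x) y) - f (row_mx x y))) =
  (fun h : R => h^-1 *: (f (h *: 'e_(lshift m2 i) + row_mx x y) - f (row_mx x y))).
  apply: funext => h; congr (_ *: (f _ - _)).
  apply/rowP => j; case: (split_ordP j) => a ->.
    by rewrite row_mxEl [RHS]mxE row_mxEl !mxE (inj_eq (@lshift_inj _ _)).
  by rewrite row_mxEr [RHS]mxE row_mxEr !mxE eq_rlshift andbF mulr0 add0r.
by split; rewrite /derivable /derive /= E.
Qed.

Lemma derive_slice_r (f : 'rV[R]_(m1 + m2) -> R) x y i :
  (derivable f (row_mx x y) 'e_(rshift m1 i) ->
   derivable (fun y => f (row_mx x y)) y 'e_i) /\
  'D_'e_i (fun y => f (row_mx x y)) y = 'D_'e_(rshift m1 i) f (row_mx x y).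
Proof.
have E : (fun h : R => h^-1 *: (f (row_mx x (h *: 'e_i + y)) - f (row_mx x y))) =
  (fun h : R => h^-1 *: (f (h *: 'e_(rshift m1 i) + row_mx x y) - f (row_mx x y))).
  apply: funext => h; congr (_ *: (f _ - _)).
  apply/rowP => j; case: (split_ordP j) => a ->.
    by rewrite row_mxEl [RHS]mxE row_mxEl !mxE eq_lrshift andbF mulr0 add0r.
  by rewrite row_mxEr [RHS]mxE row_mxEr !mxE (inj_eq (@rshift_inj _ _)).
by split; rewrite /derivable /derive /= E.
Qed.

Lemma row_mx_continuous_l (y : 'rV[R]_m2) :
  continuous (fun x : 'rV[R]_m1 => row_mx x y).
Proof.
move=> x; apply: (@cvg_rV _ _ (nbhs x)) => j.
case: (split_ordP j) => a ->.
  under eq_fun do rewrite row_mxEl.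
  by rewrite row_mxEl; exact: coord_continuous.
under eq_fun do rewrite row_mxEr.
by rewrite row_mxEr; exact: cvg_cst.
Qed.

Lemma row_mx_continuous_r (x : 'rV[R]_m1) :
  continuous (fun y : 'rV[R]_m2 => row_mx x y).
Proof.
move=> y; apply: (@cvg_rV _ _ (nbhs y)) => j.
case: (split_ordP j) => a ->.
  under eq_fun do rewrite row_mxEl.
  by rewrite row_mxEl; exact: cvg_cst.
under eq_fun do rewrite row_mxEr.
by rewrite row_mxEr; exact: coord_continuous.
Qed.

(** Freezing one factor turns the joint smoothness of multiplication, stated on [R^(n + n)], into
    smoothness of the translations. *)
Lemma Ck_on_slice_l k (W : set 'rV[R]_(m1 + m2)) f y :
  Ck_on k W f ->
  Ck_on k [set x | W (row_mx x y)] (fun x => f (row_mx x y)).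
Proof.
elim: k f => [|k IH] f.
  move=> H x Wx; apply: (@continuous_comp _ _ _ (fun x => row_mx x y) f).
    exact: row_mx_continuous_l.
  exact: H.
move=> [H1 H2]; split => [i x Wx|i].
  by apply: (derive_slice_l f x y i).1; exact: H1.
have -> : (fun x => 'D_'e_i (fun x => f (row_mx x y)) x) =
   fun x => 'D_'e_(lshift m2 i) f (row_mx x y).
  by apply: funext => x; exact: (derive_slice_l f x y i).2.
by apply: (IH (fun z => 'D_'e_(lshift m2 i) f z)); exact: H2.
Qed.

Lemma Ck_on_slice_r k (W : set 'rV[R]_(m1 + m2)) f x :
  Ck_on k W f ->
  Ck_on k [set y | W (row_mx x y)] (fun y => f (row_mx x y)).
Proof.
elim: k f => [|k IH] f.
  move=> H y Wy; apply: (@continuous_comp _ _ _ (fun y => row_mx x y) f).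
    exact: row_mx_continuous_r.
  exact: H.
move=> [H1 H2]; split => [i y Wy|i].
  by apply: (derive_slice_r f x y i).1; exact: H1.
have -> : (fun y => 'D_'e_i (fun y => f (row_mx x y)) y) =
   fun y => 'D_'e_(rshift m1 i) f (row_mx x y).
  by apply: funext => y; exact: (derive_slice_r f x y i).2.
by apply: (IH (fun z => 'D_'e_(rshift m1 i) f z)); exact: H2.
Qed.

End Slice.

Section Charts.
Variables (R : realType) (n : nat) (G : lieGroupType R n).
Implicit Types (c d : chart R n G) (f : G -> R).

Lemma cimg_open c : atlas c -> open (cimg c).
Proof. by case/atlas_chart. Qed.

Lemma cdom_open c : atlas c -> open (cdom c).
Proof. by case/atlas_chart. Qed.

Lemma cmapK c g : atlas c -> cdom c g -> cinv c (cmap c g) = g.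
Proof. by case/atlas_chart => _ _ H _ _; exact: H. Qed.

Lemma cimg_cmap c g : cdom c g -> cimg c (cmap c g).
Proof. by exists g. Qed.

Lemma cdom_cinv c x : atlas c -> cimg c x -> cdom c (cinv c x).
Proof. by move=> ac [g dg <-]; rewrite cmapK. Qed.

Lemma cinvK c x : atlas c -> cimg c x -> cmap c (cinv c x) = x.
Proof. by move=> ac [g dg <-]; rewrite cmapK. Qed.

Lemma cmap_continuous c g : atlas c -> cdom c g -> {for g, continuous (cmap c)}.
Proof. by case/atlas_chart => _ _ _ H _; exact: H. Qed.

Lemma cinv_continuous c x : atlas c -> cimg c x -> {for x, continuous (cinv c)}.
Proof. by case/atlas_chart => _ _ _ _; apply. Qed.

Lemma smooth_cst (a : R) : smooth (fun _ : G => a).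
Proof. by move=> c ac k; exact: Ck_on_cst. Qed.

Lemma smoothD f h : smooth f -> smooth h -> smooth (fun g => f g + h g).
Proof.
move=> sf sh c ac k; exact: (Ck_on_add (cimg_open ac) (sf c ac k) (sh c ac k)).
Qed.

Lemma smoothM f h : smooth f -> smooth h -> smooth (fun g => f g * h g).
Proof.
move=> sf sh c ac k; exact: (Ck_on_mul (cimg_open ac) (sf c ac k) (sh c ac k)).
Qed.

Lemma smoothN f : smooth f -> smooth (fun g => - f g).
Proof.
move=> sf; have := smoothM (smooth_cst (-1)) sf.
by under eq_fun do rewrite mulN1r.
Qed.

Lemma smoothB f h : smooth f -> smooth h -> smooth (fun g => f g - h g).
Proof. by move=> sf sh; apply: smoothD => //; exact: smoothN. Qed.

Lemma smoothV f : (forall g, f g != 0) -> smooth f -> smooth (fun g => (f g)^-1).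
Proof.
move=> f0 sf c ac k; apply: (Ck_on_inv (cimg_open ac)) => [x _|]; first exact: f0.
exact: sf.
Qed.

Lemma smooth_flat f : smooth f -> smooth (fun g => flat 0 (f g)).
Proof. by move=> sf c ac k; exact: (Ck_on_flat 0 (cimg_open ac) (sf c ac k)). Qed.

Lemma smooth_sum (I : Type) (r : seq I) (f : I -> G -> R) :
  (forall i, smooth (f i)) -> smooth (fun g => \sum_(i <- r) f i g).
Proof.
move=> H c ac k; apply: (Ck_on_sum r (cimg_open ac)) => i; exact: H.
Qed.

Lemma smooth_continuous f : smooth f -> continuous f.
Proof.
move=> sf g; have [c ac cg] := atlas_cover g.
have H : {for g, continuous ((f \o cinv c) \o cmap c)}.
  apply: continuous_comp; first exact: cmap_continuous.
  exact: (sf c ac 0%N _ (cimg_cmap cg)).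
have N : \forall h \near g, f (cinv c (cmap c h)) = f h.
  by move: (open_near (cdom_open ac) cg); apply: filterS => h ch; rewrite cmapK.
rewrite /continuous_at -[f g](nbhs_singleton N).
exact: (cvg_trans (near_eq_cvg N) H).
Qed.

Lemma smooth_comp (T : G -> G) f : continuous T ->
  (forall a c, atlas a -> atlas c ->
    smooth_map_on [set x | cimg a x /\ cdom c (T (cinv a x))]
      (fun x => cmap c (T (cinv a x)))) ->
  smooth f -> smooth (f \o T).
Proof.
move=> cT sT sf a aa k; apply: Ck_on_local => x ax.
have [c ac cx] := atlas_cover (T (cinv a x)).
exists [set x | cimg a x /\ cdom c (T (cinv a x))] => //.
have oV : open [set x | cimg a x /\ cdom c (T (cinv a x))].
  apply: (open_preimage_in (h := T \o cinv a)).
  - exact: cimg_open.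
  - move=> y ay; apply: continuous_comp; first exact: cinv_continuous.
    exact: cT.
  - exact: cdom_open.
have H := Ck_on_comp (cimg_open ac) oV
  (F := fun x => cmap c (T (cinv a x))) (f := f \o cinv c).
apply: (Ck_on_eq oV _ (H k _ _ _)).
- by move=> y [ay cy] /=; rewrite cmapK.
- by move=> y [ay cy]; exact: cimg_cmap.
- by move=> j; exact: sT.
- exact: sf.
Qed.

Lemma mulg_continuous_r (a : G) : continuous (fun g => (g * a)%g).
Proof.
move=> g; apply: (@continuous_comp _ _ _ (fun g : G => (g, a))
  (fun p : G * G => (p.1 * p.2)%g)); last exact: mulg_continuous.
by apply: cvg_pair; [exact: cvg_id|exact: cvg_cst].
Qed.

Lemma mulg_continuous_l (a : G) : continuous (fun g => (a * g)%g).
Proof.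
move=> g; apply: (@continuous_comp _ _ _ (fun g : G => (a, g))
  (fun p : G * G => (p.1 * p.2)%g)); last exact: mulg_continuous.
by apply: cvg_pair; [exact: cvg_cst|exact: cvg_id].
Qed.

Lemma smooth_mulr (b : G) f : smooth f -> smooth (fun g => f (g * b)%g).
Proof.
apply: smooth_comp; first exact: mulg_continuous_r.
move=> a c aa ac j k; have [d ad db] := atlas_cover b.
have E x : (fun z => cmap c (cinv a (lsubmx z) * cinv d (rsubmx z))%g 0 j)
      (row_mx x (cmap d b)) = cmap c (cinv a x * b)%g 0 j.
  by rewrite /= row_mxKl row_mxKr cmapK.
have H := Ck_on_slice_l (cmap d b) (mulg_smooth a d c aa ad ac j k).
rewrite (funext E) in H; move: H; apply: Ck_on_sub => x [ax cx] /=.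
rewrite row_mxKl row_mxKr cmapK //.
by split => //; exact: cimg_cmap.
Qed.

Lemma smooth_mull (b : G) f : smooth f -> smooth (fun g => f (b * g)%g).
Proof.
apply: smooth_comp; first exact: mulg_continuous_l.
move=> a c aa ac j k; have [d ad db] := atlas_cover b.
have E x : (fun z => cmap c (cinv d (lsubmx z) * cinv a (rsubmx z))%g 0 j)
      (row_mx (cmap d b) x) = cmap c (b * cinv a x)%g 0 j.
  by rewrite /= row_mxKl row_mxKr cmapK.
have H := Ck_on_slice_r (cmap d b) (mulg_smooth d a c ad aa ac j k).
rewrite (funext E) in H; move: H; apply: Ck_on_sub => x [ax cx] /=.
rewrite row_mxKl row_mxKr cmapK //.
by split => //; exact: cimg_cmap.
Qed.

Lemma smooth_invg f : smooth f -> smooth (fun g => f (g^-1)%g).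
Proof.
by apply: smooth_comp; [exact: invg_continuous|move=> a c aa ac; exact: invg_smooth].
Qed.

End Charts.

(** * Bump functions and uniform approximation *)

Section Bump.
Variables (R : realType) (n : nat).

Lemma cube_in (x : 'rV[R]_n) (A : set 'rV[R]_n) :
  nbhs x A -> exists2 r : R, 0 < r & cube x r `<=` A.
Proof.
move=> /nbhs_ballP[r /= r0 H]; exists (r / 2); first by rewrite divr_gt0.
move=> z Kz; apply: H; rewrite -ball_normE /ball_ /= distrC.
rewrite (@le_lt_trans _ _ (r / 2)) //.
  by apply/cube_norm => //; rewrite divr_ge0 // ltW.
by rewrite ltr_pdivrMr // ltr_pMr // ltr1n.
Qed.

Definition sqdist (x z : 'rV[R]_n) : R := \sum_i (z 0 i - x 0 i) ^+ 2.

(** The Euclidean distance is used because its square is a polynomial; its ball of radius [r] lies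
    in the cube of radius [r], where supports are measured. *)
Definition bumpf (x : 'rV[R]_n) (r : R) (z : 'rV[R]_n) : R :=
  flat 0 (1 - sqdist x z / r ^+ 2).

Lemma bump_ge0 x r z : 0 <= bumpf x r z. Proof. exact: flat_ge0. Qed.

Lemma bump_eq0 (x : 'rV[R]_n) (r : R) (z : 'rV[R]_n) i :
  0 < r -> r <= `|z 0 i - x 0 i| -> bumpf x r z = 0.
Proof.
move=> r0 rz; rewrite /bumpf flat_le0 // subr_le0 ler_pdivlMr ?exprn_gt0 // mul1r.
rewrite /sqdist (bigD1 i) //=.
rewrite ler_wpDr ?sumr_ge0 // => [j _|]; first exact: sqr_ge0.
by rewrite -[leRHS]real_normK ?num_real // ler_pXn2r // ?nnegrE // ltW.
Qed.

Lemma bump_out (x : 'rV[R]_n) (r : R) z : 0 < r -> ~ cube x r z -> bumpf x r z = 0.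
Proof.
move=> r0 /existsNP[i /negP]; rewrite -ltNge => /ltW; exact: bump_eq0.
Qed.

Lemma bump_center x r : 0 < r -> 0 < bumpf x r x.
Proof.
move=> r0; apply: flat_gt0; rewrite /sqdist big1 => [|i _].
  by rewrite mul0r subr0.
by rewrite subrr expr0n.
Qed.

Lemma sqdist_smooth k x (U : set 'rV[R]_n) : open U -> Ck_on k U (sqdist x).
Proof.
move=> oU; apply: Ck_on_sum => // i.
have H : Ck_on k U (fun z : 'rV[R]_n => z 0 i + - x 0 i).
  by apply: Ck_on_add => //; [exact: Ck_on_coord|exact: Ck_on_cst].
by have := Ck_on_mul oU H H.
Qed.

Lemma bump_smooth k x r (U : set 'rV[R]_n) : open U -> Ck_on k U (bumpf x r).
Proof.
move=> oU; apply: Ck_on_flat => //.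
have := Ck_on_add oU (Ck_on_cst k U 1)
  (Ck_on_mul oU (Ck_on_cst k U (- (r ^+ 2)^-1)) (sqdist_smooth k x oU)).
by under eq_fun do rewrite mulNr [_^-1 * _]mulrC.
Qed.

End Bump.

Section Extension.
Variables (R : realType) (n : nat) (G : lieGroupType R n).
Implicit Types (c d : chart R n G) (f : G -> R).

Lemma cinv_cube_compact c x r : atlas c -> cube x r `<=` cimg c ->
  compact (cinv c @` cube x r).
Proof.
move=> ac xr; apply: continuous_compact; last exact: cube_compact.
apply: continuous_in_subspaceT => z; rewrite inE => Kz.
by apply: cinv_continuous => //; exact: xr.
Qed.

Definition ext c (u : 'rV[R]_n -> R) : G -> R :=
  fun g => if `[< cdom c g >] then u (cmap c g) else 0.

Lemma ext_cinv c u z : atlas c -> cimg c z -> ext c u (cinv c z) = u z.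
Proof.
move=> ac cz; rewrite /ext; case: asboolP => [_|[]]; first by rewrite cinvK.
exact: cdom_cinv.
Qed.

(** Inside the chart domain this is a change of charts. At any other point the extension vanishes
    nearby, because the compact image of the cube is closed; this is where the Hausdorff axiom
    enters. *)
Lemma ext_smooth c x r (u : 'rV[R]_n -> R) : atlas c -> cube x r `<=` cimg c ->
  (forall z, ~ cube x r z -> u z = 0) ->
  smooth_on (cimg c) u -> smooth (ext c u).
Proof.
move=> ac xr u0 su d ad k; apply: Ck_on_local => y dy.
have oV (A : set G) : open A -> open [set y | cimg d y /\ A (cinv d y)].
  apply: open_preimage_in => [|z dz]; first exact: cimg_open.
  exact: cinv_continuous.
have [cy|ncy] := pselect (cdom c (cinv d y)).
  exists [set y | cimg d y /\ cdom c (cinv d y)] => //.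
  have oV1 := oV _ (cdom_open ac).
  have H := Ck_on_comp (cimg_open ac) oV1
    (F := fun x => cmap c (cinv d x)) (f := u).
  apply: (Ck_on_eq oV1 _ (H k _ _ _)).
  - by move=> z [dz cz]; rewrite /= /ext asboolT.
  - by move=> z [dz cz]; exact: cimg_cmap.
  - move=> j; apply: Ck_on_sub (atlas_smooth d c ad ac j k) => z [dz cz].
    by exists (cinv d z); [split => //; exact: cdom_cinv|rewrite cinvK].
  - exact: su.
have cK : closed (cinv c @` cube x r).
  by apply: compact_closed; [exact: lie_hausdorff|exact: cinv_cube_compact].
have oV2 : open [set y | cimg d y /\ (~` (cinv c @` cube x r)) (cinv d y)].
  by apply: oV; exact: closed_openC.
exists [set y | cimg d y /\ (~` (cinv c @` cube x r)) (cinv d y)].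
  split => // -[z Kz zy]; apply: ncy; rewrite -zy.
  by apply: cdom_cinv => //; exact: xr.
apply: (Ck_on_eq oV2 _ (Ck_on_cst k _ 0)) => z [dz nz].
rewrite /= /ext; case: asboolP => // cz; rewrite u0 // => Kz.
by apply: nz; exists (cmap c (cinv d z)) => //; rewrite cmapK.
Qed.

Lemma exists_bump (g0 : G) (A : set G) : nbhs g0 A ->
  exists b : G -> R, [/\ smooth b, forall g, 0 <= b g, 0 < b g0 &
    forall g, b g != 0 -> A g].
Proof.
move=> Ag; have [c ac cg] := atlas_cover g0.
have [r r0 Hr] : exists2 r : R, 0 < r &
    cube (cmap c g0) r `<=` cimg c `&` (cinv c @^-1` A).
  apply: cube_in; apply: filterI.
    exact: (open_near (cimg_open ac) (cimg_cmap cg)).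
  apply: (cinv_continuous ac (cimg_cmap cg)).
  by rewrite cmapK.
exists (ext c (bumpf (cmap c g0) r)); split.
- apply: (ext_smooth ac) => [z /Hr[]//|z|k]; first exact: bump_out.
  by apply: bump_smooth; exact: cimg_open.
- by move=> g; rewrite /ext; case: asboolP => // _; exact: bump_ge0.
- by rewrite /ext asboolT //; exact: bump_center.
- move=> g; rewrite /ext; case: asboolP => [cg' bg|_]; last by rewrite eqxx.
  have [Kg|/bump_out nK] := pselect (cube (cmap c g0) r (cmap c g)).
    by have [_ /=] := Hr _ Kg; rewrite cmapK.
  by rewrite nK // eqxx in bg.
Qed.

(** A partition of unity: [f g] is an average of finitely many values [F i] with weights [b i g],
    and a weight is nonzero only where [F i] is within [eta] of [F g]. *)
Lemma smooth_approx (K : set G) (F : G -> R) (eta : R) : compact K ->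
  continuous F -> 0 < eta ->
  exists2 f : G -> R, smooth f & forall g, K g -> `|f g - F g| <= eta.
Proof.
move=> cK cF eta0.
have [K0|/nonemptyPn->] := pselect (K !=set0); last first.
  by exists (fun=> 0) => //; exact: smooth_cst.
have /choice[b Hb] : forall g0 : G, exists b : G -> R,
    [/\ smooth b, forall g, 0 <= b g, 0 < b g0 &
      forall g, b g != 0 -> `|F g0 - F g| <= eta].
  move=> g0; apply: exists_bump.
  by have /cvgrPdist_le := cF g0; exact.
have oU g0 : open [set g | 0 < b g0 g].
  have [/smooth_continuous cb _ _ _] := Hb g0.
  by apply: open_comp (@open_gt R 0) => g _; exact: cb.
have [D KD] : exists D : seq G, forall g, K g -> exists2 i, i \in D & 0 < b i g.
  (* The filter of finite lists directed by inclusion; near-covering compactness along it is the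
     extraction of a finite subcover. *)
  pose FF := [set P : set (seq G) | exists s0 : seq G,
    forall s : seq G, {subset s0 <= s} -> P s].
  have FFF : Filter FF.
    split; first by exists [::].
      move=> P Q [s0 H0] [s1 H1]; exists (s0 ++ s1) => s Hs; split.
        by apply: H0 => z zs; apply: Hs; rewrite mem_cat zs.
      by apply: H1 => z zs; apply: Hs; rewrite mem_cat zs orbT.
    by move=> P Q PQ [s0 H0]; exists s0 => s /H0; exact: PQ.
  have [] := (@compact_near_coveringP _ K).1 cK (seq G) FF
    (fun s g => exists2 i, i \in s & 0 < b i g) FFF.
    move=> x Kx; exists ([set g | 0 < b x g], [set s : seq G | x \in s]) => /=.
      split; last by exists [:: x] => s; apply; rewrite mem_head.
      by apply: (open_near (oU x)) => /=; have [] := Hb x.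
    by move=> [g s] /= [bg xs]; exists x.
  by move=> D HD; exists D; exact: HD.
pose B g := \sum_(i <- D) b i g.
have sB : smooth B by apply: smooth_sum => i; have [] := Hb i.
have b0 i g : 0 <= b i g by have [] := Hb i.
have Bpos g : K g -> 0 < B g.
  move=> /KD[i iD big]; rewrite /B (big_rem i) //= ltr_pwDl //.
  by apply: sumr_ge0.
have [c Kc Hc] := compact_EVT_min K0 cK (continuous_subspaceT (smooth_continuous sB)).
rewrite inE in Kc; have c0 := Bpos _ Kc.
(* The second term vanishes on K and makes Q positive everywhere. *)
pose Q g := B g + flat 0 (B c - B g).
have Q0 g : 0 < Q g.
  have B0 : 0 <= B g by apply: sumr_ge0.
  have [Bc|Bc] := ltP (B g) (B c).
    by rewrite ltr_wpDl // flat_gt0 // subr_gt0.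
  by rewrite /Q flat_le0 ?addr0 ?subr_le0 // (lt_le_trans c0).
pose N g := \sum_(i <- D) F i * b i g.
exists (fun g => N g * (Q g)^-1).
  apply: smoothM.
    by apply: smooth_sum => i; apply: smoothM; [exact: smooth_cst|have [] := Hb i].
  apply: smoothV => [g|]; first by rewrite gt_eqF.
  by apply: smoothD => //; apply: smooth_flat; apply: smoothB => //; exact: smooth_cst.
move=> g Kg; have Bg := Bpos _ Kg.
have -> : Q g = B g by rewrite /Q flat_le0 ?addr0 // subr_le0 Hc // inE.
have -> : N g / B g - F g = (\sum_(i <- D) b i g * (F i - F g)) / B g.
  have -> : \sum_(i <- D) b i g * (F i - F g) = N g - B g * F g.
    rewrite /N /B mulr_suml -sumrB; apply: eq_bigr => i _.
    by rewrite mulrBr [F i * _]mulrC.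
  by rewrite mulrBl [B g * _]mulrC mulfK // gt_eqF.
rewrite normrM normfV (ger0_norm (ltW Bg)) ler_pdivrMr //.
apply: (le_trans (ler_norm_sum _ _ _)).
rewrite /B mulr_sumr; apply: ler_sum => i _.
rewrite normrM (ger0_norm (b0 _ _)) mulrC.
have [->|big] := eqVneq (b i g) 0; first by rewrite !mulr0.
by rewrite ler_wpM2r //; have [_ _ _] := Hb i; exact.
Qed.

End Extension.

(** * Flows and divergence in a chart *)

Lemma continuous_pair_l (T U : topologicalType) (t : T) :
  continuous (fun u : U => (t, u)).
Proof. by move=> u; apply: cvg_pair; [exact: cvg_cst|exact: cvg_id]. Qed.

Lemma continuous_pair_r (T U : topologicalType) (u : U) :
  continuous (fun t : T => (t, u)).
Proof. by move=> t; apply: cvg_pair; [exact: cvg_id|exact: cvg_cst]. Qed.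

Lemma cvg_sum0 (R : realType) (I : Type) (s : seq I) (u : I -> nat -> R) :
  (forall i, u i N @[N --> \oo] --> 0) ->
  \sum_(i <- s) u i N @[N --> \oo] --> 0.
Proof.
move=> H; elim: s => [|i s IH].
  by under eq_fun do rewrite big_nil; exact: cvg_cst.
have -> : (fun N => \sum_(j <- i :: s) u j N) =
    (fun N => u i N + \sum_(j <- s) u j N).
  by apply: funext => N; rewrite big_cons.
have H2 : u i N + \sum_(j <- s) u j N @[N --> \oo] --> 0 + 0.
  exact: cvgD (H i) IH.
by rewrite addr0 in H2.
Qed.

Section Plateau.
Variables (R : realType) (n : nat) (p : 'rV[R]_n) (r : R).
Hypothesis r0 : 0 < r.

(** The second term of the denominator vanishes exactly for [sqdist p z <= r^2 / 2], where the
    quotient is therefore 1. This region contains the cube of radius [r / n.+1], since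
    [n / (n + 1)^2 <= 1/2]. *)
Definition plateau (z : 'rV[R]_n) : R :=
  bumpf p r z * (bumpf p r z + flat 0 (sqdist p z / r ^+ 2 - 2^-1))^-1.

Lemma sqdist_cube (e : R) z : cube p e z -> sqdist p z <= n%:R * e ^+ 2.
Proof.
move=> Kz; have -> : n%:R * e ^+ 2 = \sum_(i < n) e ^+ 2.
  by rewrite sumr_const card_ord mulr_natl.
apply: ler_sum => i _; rewrite -[leLHS]real_normK ?num_real //.
by rewrite lerXn2r // nnegrE ?(le_trans _ (Kz i)).
Qed.

Lemma plateau_smooth k (U : set 'rV[R]_n) : open U -> Ck_on k U plateau.
Proof.
move=> oU; have B := bump_smooth k p r oU.
apply: Ck_on_mul => //; apply: Ck_on_inv => // [z _|].
  have [h|h] := ltP (sqdist p z / r ^+ 2) 1.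
    by rewrite gt_eqF // ltr_pwDl ?flat_ge0 // flat_gt0 // subr_gt0.
  have F0 : 0 < flat 0 (sqdist p z / r ^+ 2 - 2^-1).
    apply: flat_gt0; rewrite subr_gt0; apply: (lt_le_trans _ h).
    by rewrite invf_lt1 // ltr1n.
  by rewrite gt_eqF // (ltr_wpDl _ F0) // bump_ge0.
apply: Ck_on_add => //; apply: Ck_on_flat => //.
apply: Ck_on_add => //; last exact: Ck_on_cst.
by apply: Ck_on_mul => //; [exact: sqdist_smooth|exact: Ck_on_cst].
Qed.

Lemma plateau_out z : ~ cube p r z -> plateau z = 0.
Proof. by move=> nz; rewrite /plateau bump_out // mul0r. Qed.

Lemma plateau_in z : cube p (r / n.+1%:R) z -> plateau z = 1.
Proof.
move=> Kz; have r2 : 0 < r ^+ 2 by rewrite exprn_gt0.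
have h : sqdist p z / r ^+ 2 <= 2^-1.
  rewrite ler_pdivrMr // (le_trans (sqdist_cube Kz)) //.
  rewrite exprMn mulrCA [leRHS]mulrC ler_pM2l // exprVn.
  rewrite ler_pdivrMr ?exprn_gt0 ?ltr0n // -[n.+1%:R]natr1.
  by have := sqr_ge0 (n%:R : R); nra.
rewrite /plateau (@flat_le0 _ _ (_ - _)) ?subr_le0 // addr0 divff //.
rewrite gt_eqF // flat_gt0 // subr_gt0 (le_lt_trans h) //.
by rewrite invf_lt1 // ltr1n.
Qed.

End Plateau.

Section Flows.
Variables (R : realType) (n : nat) (G : lieGroupType R n).

(** A common interface for left translations by [exp(tX)], generated by a right-invariant field, and
    right translations, generated by a left-invariant one. The derivative is required at time 0
    only; the group law carries it to all times. *)
Record flow (T : R -> G -> G) (D : (G -> R) -> G -> R) : Prop := Flow {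
  flowD : forall s t g, T (s + t) g = T s (T t g);
  flow0 : forall g, T 0 g = g;
  flow_continuous : continuous (fun q : R * G => T q.1 q.2);
  flow_smooth : forall s f, smooth f -> smooth (fun g => f (T s g));
  flow_deriv_smooth : forall f, smooth f -> smooth (D f);
  flow_deriv0 : forall f g, smooth f ->
    is_derive (0 : R) (1 : R) (fun h => f (T h g)) (D f g) }.

Variables (T : R -> G -> G) (D : (G -> R) -> G -> R).
Hypothesis TD : flow T D.

Lemma flow_deriv f g t : smooth f ->
  is_derive t (1 : R) (fun h => f (T h g)) (D f (T t g)).
Proof.
move=> sf; have [h1 h2] := flow_deriv0 TD (T t g) sf.
have E : (fun h : R => h^-1 *: (f (T (h *: (1 : R) + t) g) - f (T t g))) =
  (fun h : R => h^-1 *: (f (T (h *: (1 : R) + 0) (T t g)) - f (T 0 (T t g)))).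
  by apply: funext => h; rewrite addr0 (flow0 TD) -(flowD TD).
by split; rewrite /derivable /derive /= E.
Qed.

(** The flow determines [D] on smooth functions, so the derivation rules for [D] reduce to those of
    one-variable calculus. *)
Lemma flow_derivE f g a : smooth f ->
  is_derive (0 : R) (1 : R) (fun h => f (T h g)) a -> D f g = a.
Proof. by move=> sf [_ <-]; have [_ ->] := flow_deriv0 TD g sf. Qed.

Lemma flow_derivM f h g : smooth f -> smooth h ->
  D (fun g => f g * h g) g = D f g * h g + f g * D h g.
Proof.
move=> sf sh; apply: flow_derivE; first exact: smoothM.
have H := is_deriveM (flow_deriv0 TD g sf) (flow_deriv0 TD g sh).
apply: (is_derive_eq H); rewrite !(flow0 TD) addrC [_ *: _]mulrC; congr (_ + _).
Qed.

Lemma flow_derivD f h g : smooth f -> smooth h ->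
  D (fun g => f g + h g) g = D f g + D h g.
Proof.
move=> sf sh; apply: flow_derivE; first exact: smoothD.
exact: is_deriveD (flow_deriv0 TD g sf) (flow_deriv0 TD g sh).
Qed.

(** A field is invariant under its own flow, since times add commutatively. *)
Lemma flow_deriv_comp t f g : smooth f ->
  D (fun g => f (T t g)) g = D f (T t g).
Proof.
move=> sf; apply: flow_derivE; first exact: (flow_smooth TD t sf).
have := flow_deriv0 TD (T t g) sf.
by under eq_fun do rewrite -(flowD TD) addrC (flowD TD).
Qed.

Lemma flow_continuous_l g : continuous (T ^~ g).
Proof.
move=> t; apply: (@continuous_comp _ _ _ (fun t : R => (t, g)) (fun q => T q.1 q.2)).
  exact: continuous_pair_r.
exact: (flow_continuous TD).
Qed.

End Flows.

Section BaseChart.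
Variables (R : realType) (n : nat) (G : lieGroupType R n).
Variables (c : chart R n G) (ac : atlas c) (p : 'rV[R]_n) (r : R).
Hypotheses (r0 : 0 < r) (pr : cube p r `<=` cimg c).

(** The radius of the inner cube, on which [plateau] equals 1 and cut-off objects coincide with the
    original ones. *)
Local Notation r1 := (r / n.+1%:R).

Lemma r1_gt0 : 0 < r1. Proof. by rewrite divr_gt0 // ltr0n. Qed.

Lemma r1_le : r1 <= r.
Proof. by rewrite ler_pdivrMr ?ltr0n // ler_peMr ?ler1n // ltW. Qed.

Lemma cube_sub (e e' : R) : e <= e' -> cube p e `<=` cube p e'.
Proof. by move=> ee z Kz i; apply: (le_trans (Kz i)). Qed.

Definition gmean (e : R) (N : nat) (f : G -> R) : R :=
  mean p e N (fun z => f (cinv c z)).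

(* The support lies in half the cube, so that test functions vanish near the
   boundary of the cube of radius e over which means are taken. *)
Definition test (e : R) (f : G -> R) : Prop := smooth f /\
  forall g, f g != 0 -> cdom c g /\ cube p (e / 2) (cmap c g).

Lemma testM e f h : test e f -> smooth h -> test e (fun g => f g * h g).
Proof.
move=> [sf tf] sh; split; first exact: smoothM.
by move=> g; rewrite mulf_eq0 negb_or => /andP[/tf].
Qed.

Lemma testMr e f h : smooth h -> test e f -> test e (fun g => h g * f g).
Proof.
by move=> sh tf; under [X in test e X]eq_fun do rewrite mulrC; exact: testM.
Qed.

Lemma testD e f h : test e f -> test e h -> test e (fun g => f g + h g).
Proof.
move=> [sf tf] [sh th]; split; first exact: smoothD.
move=> g; have [->|/tf//] := eqVneq (f g) 0.
by rewrite add0r => /th.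
Qed.

(** Fields act on functions defined on all of [G], so coordinates are cut off before their
    components are read off by applying [D]. *)
Definition coordf (i : 'I_n) : G -> R := ext c (fun z => plateau p r z * z 0 i).

Lemma coordf_smooth i : smooth (coordf i).
Proof.
apply: (ext_smooth ac pr) => [z nz|k]; first by rewrite plateau_out // mul0r.
have oc := cimg_open ac.
apply: Ck_on_mul => //; [exact: plateau_smooth|exact: Ck_on_coord].
Qed.

Lemma coordfE i g : cdom c g -> cube p r1 (cmap c g) ->
  coordf i g = cmap c g 0 i.
Proof. by move=> cg Kg; rewrite /coordf /ext asboolT // plateau_in // mul1r. Qed.

Lemma near_cube (e : R) (z : 'rV[R]_n) : (forall i, `|z 0 i - p 0 i| < e) ->
  nbhs z [set z' : 'rV[R]_n | forall i, `|z' 0 i - p 0 i| < e].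
Proof.
move=> Hz.
near=> z' => i; move: i; near: z'; apply: filter_forall => i.
have C : {for z, continuous (fun z : 'rV[R]_n => `|z 0 i - p 0 i|)}.
  apply: continuous_comp; last exact: norm_continuous.
  exact: (cvgB (@coord_continuous R 1 n 0 i z) (cvg_cst (p 0 i))).
exact: (C _ (open_near (@open_lt R e) (Hz i))).
Unshelve. all: by end_near. Qed.

Section OneFlow.
Variables (T : R -> G -> G) (D : (G -> R) -> G -> R).
Hypothesis TD : flow T D.

Definition vcomp (i : 'I_n) : G -> R := D (coordf i).

Lemma vcomp_smooth i : smooth (vcomp i).
Proof. by apply: (flow_deriv_smooth TD); exact: coordf_smooth. Qed.

(** The chain rule along the orbit [h |-> T h g] read in the chart. Continuity of the flow keeps the
    orbit in the inner cube for small [h], so its velocity has components [vcomp i]. *)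
Lemma flow_deriv_coord f (z : 'rV[R]_n) : smooth f -> cube p r z ->
  (forall i, `|z 0 i - p 0 i| < r1) ->
  D f (cinv c z) =
    \sum_i vcomp i (cinv c z) * 'D_'e_i (fun z => f (cinv c z)) z.
Proof.
move=> sf Kz zr; have cz := pr Kz.
set g := cinv c z; have cg : cdom c g by exact: cdom_cinv.
have mg : cmap c g = z by rewrite cinvK.
pose cv (h : R) := cmap c (T h g).
have cTg : {for 0, continuous (T ^~ g)} by exact: (flow_continuous_l TD).
have N1 : \forall h \near (0 : R), cdom c (T h g).
  by apply: cTg; rewrite /= (flow0 TD); exact: (open_near (cdom_open ac) cg).
have cv0 : cv 0 = z by rewrite /cv (flow0 TD).
have cvc : {for 0, continuous cv}.
  apply: (@continuous_comp _ _ _ (T ^~ g) (cmap c)) => //.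
  by rewrite (flow0 TD); exact: cmap_continuous.
have N2 : \forall h \near (0 : R), forall i, `|cv h 0 i - p 0 i| < r1.
  by have := near_cube zr; rewrite -cv0 => /cvc.
pose v : 'rV[R]_n := \row_i vcomp i g.
have dcv i : is_derive (0 : R) (1 : R) (fun h => cv h 0 i) (v 0 i).
  rewrite mxE; have H := flow_deriv0 TD g (coordf_smooth i).
  apply: near_eq_is_derive H; near=> h.
  have ch : cdom c (T h g) by near: h.
  rewrite coordfE // => j; apply: ltW.
  by move: j; near: h.
have [d1 d2] := Ck_on_diff (cimg_open ac) (sf c ac 1%N) cz.
have := is_derive_comp_rV dcv; rewrite cv0 => /(_ (f \o cinv c) d1 d2) H.
have H' : is_derive (0 : R) (1 : R) (fun h => f (T h g)) (grad (f \o cinv c) z v).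
  apply: near_eq_is_derive H; near=> h.
  have ch : cdom c (T h g) by near: h.
  by rewrite /= /cv cmapK.
rewrite (flow_derivE TD sf H') /grad; apply: eq_bigr => i _.
by rewrite mxE.
Unshelve. all: by end_near. Qed.

(** The divergence for Lebesgue measure in the chart, cut off to be smooth on [G]; it is the true
    divergence on the inner cube. *)
Definition divg : G -> R := fun g => \sum_(i <- index_enum 'I_n)
  ext c (fun z => plateau p r z * 'D_'e_i (fun z => vcomp i (cinv c z)) z) g.

Lemma divg_smooth : smooth divg.
Proof.
apply: smooth_sum => i.
apply: (ext_smooth ac pr) => [z nz|k]; first by rewrite plateau_out // mul0r.
have oc := cimg_open ac.
apply: Ck_on_mul => //; first exact: plateau_smooth.
by have [_ H] := vcomp_smooth i ac k.+1; exact: H.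
Qed.

Lemma divgE z : cube p r1 z ->
  divg (cinv c z) = \sum_i 'D_'e_i (fun z => vcomp i (cinv c z)) z.
Proof.
move=> Kz; rewrite /divg; apply: eq_bigr => i _; rewrite ext_cinv //.
  by rewrite plateau_in // mul1r.
by apply/pr/(cube_sub r1_le).
Qed.

(* Minus the formal adjoint of D for Lebesgue measure in the chart. *)
Definition dual (f : G -> R) : G -> R := fun g => D f g + divg g * f g.

(** [D] is local: a point off the compact set carrying the support has a short piece of orbit off it
    too, along which [f] is 0. *)
Lemma test_deriv e f : e / 2 <= r -> test e f -> test e (D f).
Proof.
move=> er [sf tf]; split; first exact: (flow_deriv_smooth TD sf).
have sub : cube p (e / 2) `<=` cimg c by move=> z /(cube_sub er)/pr.
pose K := cinv c @` cube p (e / 2).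
have oK : open (~` K).
  apply: closed_openC; apply: compact_closed; first exact: lie_hausdorff.
  exact: cinv_cube_compact.
move=> g; apply: contra_neqP => ng.
have nK : (~` K) g.
  move=> [z Kz zg]; apply: ng; rewrite -zg; split.
    by apply: cdom_cinv => //; exact: sub.
  by rewrite cinvK //; exact: sub.
apply: (flow_derivE TD sf).
have N : \forall h \near (0 : R), 0 = f (T h g).
  have cTg : {for 0, continuous (T ^~ g)} by exact: (flow_continuous_l TD).
  have : \forall h \near (0 : R), (~` K) (T h g).
    by apply: cTg; rewrite /= (flow0 TD); exact: open_near.
  apply: filterS => h nKh; apply/esym/eqP; apply: contraT => /tf[ch Kh].
  by case: nKh; exists (cmap c (T h g)) => //; rewrite cmapK.
exact: (near_eq_is_derive N (is_derive_cst (0 : R) (0 : R) (1 : R))).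
Qed.

Lemma test_dual e f : e / 2 <= r -> test e f -> test e (dual f).
Proof.
move=> er tf; apply: testD; first exact: test_deriv.
exact: (testMr divg_smooth tf).
Qed.

(** The divergence theorem: in the chart [dual f] is the sum of the [i]-th partial derivatives of
    [vcomp i * f], and a test function vanishes on the faces of the cube. *)
Lemma gmean_dual e f : 0 < e -> e < r1 -> test e f ->
  gmean e N (dual f) @[N --> \oo] --> 0.
Proof.
move=> e0 er [sf tf].
have inr z : cube p e z -> cube p r z.
  by apply: cube_sub; apply: (le_trans (ltW er)); exact: r1_le.
pose F i z := vcomp i (cinv c z) * f (cinv c z).
have CF i : smooth (fun g => vcomp i g * f g).
  by apply: smoothM => //; exact: vcomp_smooth.
have H i : mean p e N ('D_'e_i (F i)) @[N --> \oo] --> 0.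
  have [d1 d2] := CF i c ac 1%N.
  apply: mean_derive_cvg0 => // z Kz; [|exact/d2/pr/inr|].
    exact/d1/pr/inr.
  move=> ze; rewrite /F; have [->|/tf[_ /(_ i)]] := eqVneq (f (cinv c z)) 0.
    by rewrite mulr0.
  rewrite cinvK //; last exact/pr/inr.
  rewrite ze ler_pdivlMr // ger_pMr // => /(lt_le_trans (ltr1n R 2)).
  by rewrite ltxx.
have -> : (fun N => gmean e N (dual f)) =
    fun N => \sum_(i <- index_enum 'I_n) mean p e N ('D_'e_i (F i)).
  apply: funext => N.
  have -> : \sum_(i <- index_enum 'I_n) mean p e N ('D_'e_i (F i)) =
     mean p e N (fun z => \sum_i 'D_'e_i (F i) z).
    rewrite /mean -mulr_suml exchange_big /=; congr (_ / _).
  apply: eq_mean => // z Kz; rewrite /dual.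
  have zr i : `|z 0 i - p 0 i| < r1 by apply: le_lt_trans er; exact: Kz.
  rewrite flow_deriv_coord //; last exact: inr.
  rewrite divgE; last by move=> i; exact: ltW.
  rewrite mulr_suml -big_split /=; apply: eq_bigr => i _.
  have [df _] := sf c ac 1%N; have [dv _] := vcomp_smooth i ac 1%N.
  have cz : cimg c z by exact/pr/inr.
  have := deriveM (dv i z cz) (df i z cz); rewrite /F /= => E.
  by rewrite [RHS]E [X in _ = _ + X]mulrC.
exact: cvg_sum0.
Qed.

End OneFlow.
End BaseChart.

(** * Integration by parts along a flow *)

Lemma is_derive_cM (R : realType) (a : R) (f : R -> R) (t df : R) :
  is_derive t (1 : R) f df -> is_derive t (1 : R) (fun x => a * f x) (a * df).
Proof. by move=> H; exact: (is_deriveZ a H). Qed.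

Lemma is_derive_sumf (R : realType) (V : normedModType R) (I : Type) (s : seq I)
    (f : I -> V -> R) (df : I -> R) (t v : V) :
  (forall i, is_derive t v (f i) (df i)) ->
  is_derive t v (fun x => \sum_(i <- s) f i x) (\sum_(i <- s) df i).
Proof.
move=> H; elim: s => [|i s IH].
  rewrite big_nil; have -> : (fun x => \sum_(i <- [::]) f i x) = cst 0.
    by apply: funext => x; rewrite big_nil.
  exact: is_derive_cst.
rewrite big_cons; have -> : (fun x => \sum_(j <- i :: s) f j x) =
    (fun x => f i x + \sum_(j <- s) f j x).
  by apply: funext => x; rewrite big_cons.
exact: is_deriveD (H i) IH.
Qed.

Lemma unif_near (R : realType) (T : topologicalType) (K : set T)
    (Phi : R -> T -> R) (t eta : R) : compact K -> 0 < eta ->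
  continuous (fun q : R * T => Phi q.1 q.2) ->
  \forall t' \near t, forall g, K g -> `|Phi t' g - Phi t g| <= eta.
Proof.
move=> cK eta0 cPhi.
have e2 : 0 < eta / 2 by rewrite divr_gt0.
apply: ((@compact_near_coveringP _ K).1 cK R (nbhs t)
  (fun t' g => `|Phi t' g - Phi t g| <= eta) _) => g0 Kg0.
have /cvgrPdist_le/(_ _ e2) H1 := cPhi (t, g0).
have cl : {for g0, continuous (Phi t)}.
  apply: (@continuous_comp _ _ _ (fun g : T => (t, g)) (fun q => Phi q.1 q.2)).
    exact: continuous_pair_l.
  exact: cPhi.
have /cvgrPdist_le/(_ _ e2) H2 := cl.
have S : nbhs (g0, t) [set q : T * R | `|Phi t g0 - Phi q.2 q.1| <= eta / 2].
  have [[A B] /= [At Bg] AB] := H1.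
  exists (B, A) => //= -[g t'] /= [Bg' At']; exact: (AB (t', g)).
have S2 : nbhs (g0, t) [set q : T * R | `|Phi t g0 - Phi t q.1| <= eta / 2].
  exists ([set g | `|Phi t g0 - Phi t g| <= eta / 2], setT) => /=.
    by split => //; exact: filterT.
  by move=> [g t'] /= [].
apply: filterS2 S S2 => -[g t'] /= h1 h2.
rewrite -(subrKA (Phi t g0)) (le_trans (ler_normD _ _)) // (splitr eta).
by rewrite lerD // distrC.
Qed.

Section Transport.
Variables (R : realType) (n : nat) (G : lieGroupType R n).
Variables (c : chart R n G) (ac : atlas c) (p : 'rV[R]_n) (r : R).
Hypotheses (r0 : 0 < r) (pr : cube p r `<=` cimg c).

Local Notation r1 := (r / n.+1%:R).
Local Notation gmean := (gmean c p).
Local Notation test := (test c p).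

Section Mean.
Variable e : R.
Hypotheses (e0 : 0 < e) (er : e < r1).

Definition box : set G := cinv c @` cube p e.

Lemma cube_e_sub : cube p e `<=` cimg c.
Proof.
move=> z Kz; apply: pr; apply: cube_sub Kz.
by apply: (le_trans (ltW er)); exact: r1_le.
Qed.

Lemma box_compact : compact box.
Proof. by apply: cinv_cube_compact => //; exact: cube_e_sub. Qed.

Lemma gmeanD N f h : gmean e N (fun g => f g + h g) = gmean e N f + gmean e N h.
Proof. exact: meanD. Qed.

Lemma gmeanZ N a f : gmean e N (fun g => a * f g) = a * gmean e N f.
Proof. exact: meanZ. Qed.

Lemma gmeanB N f h : gmean e N (fun g => f g - h g) = gmean e N f - gmean e N h.
Proof.
rewrite gmeanD; congr (_ + _); rewrite -mulN1r -gmeanZ.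
by congr (gmean e N _); apply: funext => g; rewrite mulN1r.
Qed.

Lemma gmean_norm_le N (f : G -> R) b :
  (forall g, box g -> `|f g| <= b) -> `|gmean e N f| <= b.
Proof. by move=> H; apply: mean_norm_le => // z Kz; apply: H; exists z. Qed.

Lemma continuous_box_bounded (f : G -> R) : continuous f ->
  exists2 C : R, 0 <= C & forall g, box g -> `|f g| <= C.
Proof.
move=> cf; have [|C C0 HC] := @cube_bounded R n p e (fun z => f (cinv c z)).
  move=> z Kz; apply: continuous_comp; last exact: cf.
  by apply: cinv_continuous => //; exact: cube_e_sub.
by exists C => // g [z Kz <-]; exact: HC.
Qed.

(** A mean is bounded by the supremum over the box, so the means are equicontinuous in [t],
    uniformly in [N]; compactness of [[0, s]] then makes the pointwise limit uniform. *)
Lemma gmean_unif (Phi : R -> G -> R) (s eta : R) :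
  continuous (fun q : R * G => Phi q.1 q.2) ->
  (forall t, gmean e N (Phi t) @[N --> \oo] --> 0) -> 0 < eta ->
  \forall N \near \oo, forall t, 0 <= t <= s -> `|gmean e N (Phi t)| <= eta.
Proof.
move=> cPhi HPhi eta0.
have e2 : 0 < eta / 2 by rewrite divr_gt0.
have := (@compact_near_coveringP _ `[(0 : R), s]%classic).1 (@segment_compact R 0 s).
move=> /(_ nat (\oo : set_system nat)
  (fun N t => `|gmean e N (Phi t)| <= eta) _) [].
  move=> t _.
  have H1 := unif_near t box_compact e2 cPhi.
  have /cvgr0Pnorm_le/(_ _ e2) H2 := HPhi t.
  exists ([set t' | forall g, box g -> `|Phi t' g - Phi t g| <= eta / 2],
          [set N | `|gmean e N (Phi t)| <= eta / 2]) => //= -[t' N] /= [h1 h2].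
  have -> : gmean e N (Phi t') =
      gmean e N (fun g => Phi t' g - Phi t g) + gmean e N (Phi t).
    by rewrite gmeanB subrK.
  rewrite (le_trans (ler_normD _ _)) // (splitr eta) lerD //.
  exact: gmean_norm_le.
move=> N _ HN; exists N => // m Nm t t01; exact: (HN m).
Qed.

End Mean.

Section Flow.
Variables (T : R -> G -> G) (D : (G -> R) -> G -> R).
Hypothesis TD : flow T D.
Local Notation dual := (dual c p r D).

(* F need not be differentiable in other directions, so F is first replaced by a
   smooth f that is eta * s close to it; then (f (T s g) - f g) / s is a derivative
   at some time t in [0, s], to which the divergence theorem applies. *)
Lemma transport (e : R) (F F' rho : G -> R) : 0 < e -> e < r1 -> continuous F ->
  (forall eta : R, 0 < eta -> \forall s \near 0^'+, forall g, box e g ->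
     `|s^-1 * (F (T s g) - F g) - F' g| <= eta) ->
  test e rho ->
  gmean e N (fun g => rho g * F' g + F g * dual rho g) @[N --> \oo] --> 0.
Proof.
move=> e0 er cF HF trho; have [srho _] := trho.
have er2 : e / 2 <= r.
  apply: (@le_trans _ _ e); first by rewrite ler_pdivrMr // ler_peMr ?ler1n // ltW.
  by apply: (le_trans (ltW er)); exact: r1_le.
have [skap _] := test_dual ac r0 pr TD er2 trho.
have bK := box_compact er.
have [M1 M10 HM1] := continuous_box_bounded er (smooth_continuous srho).
have [M2 M20 HM2] := continuous_box_bounded er (smooth_continuous skap).
pose M := M1 + M2.
have M0 : 0 <= M by rewrite addr_ge0.
have HM1' g : box e g -> `|rho g| <= M.
  by move=> /HM1/le_trans; apply; rewrite lerDl.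
have HM2' g : box e g -> `|dual rho g| <= M.
  by move=> /HM2/le_trans; apply; rewrite lerDr.
apply/cvgr0Pnorm_le => eps eps0.
(* The final error is [3 * M * eta] from the difference quotient, [eta] from the divergence theorem
   and [2 * M * eta] from moving along the flow. *)
pose eta := eps / (1 + 5 * M).
have eta0 : 0 < eta by rewrite divr_gt0 // ltr_pwDl // mulr_ge0.
have cTF : continuous (fun q : R * G => F (T q.1 q.2)).
  move=> q; apply: (@continuous_comp _ _ _ (fun q : R * G => T q.1 q.2) F).
    exact: (flow_continuous TD).
  exact: cF.
have [s [s0 s1 Hs Ht]] : exists s : R, [/\ 0 < s, s <= 1,
    forall g, box e g -> `|s^-1 * (F (T s g) - F g) - F' g| <= eta &
    forall t g, 0 <= t <= s -> box e g -> `|F (T t g) - F g| <= eta].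
  have := unif_near (Phi := fun t g => F (T t g)) 0 bK eta0 cTF.
  move=> /nbhs_ballP[d /= d0 Hd].
  have : \forall s \near 0^'+, [/\ 0 < s, s <= 1, s < d &
    forall g, box e g -> `|s^-1 * (F (T s g) - F g) - F' g| <= eta].
    near=> s; split; near: s.
    - exact: nbhs_right_gt.
    - exact: nbhs_right_le.
    - exact: nbhs_right_lt.
    - exact: HF.
  move=> /filter_ex[s [s0 s1 sd Hs]]; exists s; split => // t g /andP[t0 ts] Kg.
  have bt : ball (0 : R) d t.
    by rewrite -ball_normE /ball_ /= sub0r normrN ger0_norm // (le_lt_trans ts).
  by have := Hd t bt g Kg; rewrite (flow0 TD).
(* Everything reached from the box up to time [s]. The approximation on this set is within
   [eta * s], because it is divided by [s] in the quotient; hence [s] is fixed before [f]. *)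
pose Ks := (fun q : R * G => T q.1 q.2) @` (`[0, s]%classic `*` box e).
have cKs : compact Ks.
  apply: continuous_compact.
    by apply: continuous_subspaceT; exact: (flow_continuous TD).
  by apply: compact_setX => //; exact: segment_compact.
have es0 : 0 < eta * s by rewrite mulr_gt0.
have [f sf Hf] := smooth_approx cKs cF es0.
have Hf' t g : 0 <= t <= s -> box e g -> `|f (T t g) - F (T t g)| <= eta * s.
  by move=> ts Kg; apply: Hf; exists (t, g) => //=; rewrite in_itv.
pose Phi t g := rho g * D f (T t g) + f (T t g) * dual rho g.
have cf := smooth_continuous sf.
have cDf := smooth_continuous (flow_deriv_smooth TD sf).
have cPhi : continuous (fun q : R * G => Phi q.1 q.2).
  move=> q; have C2 (h : G -> R) : continuous h ->
      {for q, continuous (fun q : R * G => h q.2)}.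
    move=> ch; apply: continuous_comp; [exact: cvg_snd|exact: ch].
  have CT (h : G -> R) : continuous h ->
      {for q, continuous (fun q : R * G => h (T q.1 q.2))}.
    move=> ch; apply: (@continuous_comp _ _ _ (fun q : R * G => T q.1 q.2) h).
      exact: (flow_continuous TD).
    exact: ch.
  exact: (continuousD
    (continuousM (C2 _ (smooth_continuous srho)) (CT _ cDf))
    (continuousM (CT _ cf) (C2 _ (smooth_continuous skap)))).
(* The Leibniz rule puts the whole integrand in divergence form, for every fixed [t]. *)
have PhiE t : Phi t = dual (fun g => rho g * f (T t g)).
  apply: funext => g; rewrite /Phi /dual.
  rewrite (flow_derivM TD g srho (flow_smooth TD t sf)).
  by rewrite (flow_deriv_comp TD) //; ring.
have PhiN t : gmean e N (Phi t) @[N --> \oo] --> 0.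
  rewrite PhiE; apply: (gmean_dual ac r0 pr TD e0 er).
  by apply: testM => //; exact: (flow_smooth TD).
have HN := gmean_unif e0 er s cPhi PhiN eta0.
near=> N.
have HN0 : forall t, 0 <= t <= s -> `|gmean e N (Phi t)| <= eta by near: N.
pose psi t := gmean e N (fun g => rho g * f (T t g)).
have dpsi t : is_derive t (1 : R) psi (gmean e N (fun g => rho g * D f (T t g))).
  rewrite /psi /gmean /mean.
  set C := (_%:R)^-1.
  have H := is_derive_sumf (index_enum (grid n N)) (fun k => is_derive_cM
     (rho (cinv c (gpt p e k))) (flow_deriv TD (cinv c (gpt p e k)) t sf)).
  rewrite [X in is_derive _ _ _ X]mulrC.
  have -> : (fun t => (\sum_(k : grid n N)
      rho (cinv c (gpt p e k)) * f (T t (cinv c (gpt p e k)))) * C) =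
    (fun t => C * \sum_(k : grid n N)
      rho (cinv c (gpt p e k)) * f (T t (cinv c (gpt p e k)))).
    by apply: funext => t'; rewrite mulrC.
  exact: is_derive_cM.
have cpsi : {within `[0, s], continuous psi}.
  by apply: derivable_within_continuous => x _; have [] := dpsi x.
(* The time [t] depends on [N], which is why smallness of the means of [Phi t] had to be uniform in
   [t]. *)
have [t ts psiE] := MVT_segment (ltW s0) (fun x _ => dpsi x) cpsi.
rewrite in_itv /= in ts; rewrite subr0 in psiE.
have -> : gmean e N (fun g => rho g * F' g + F g * dual rho g) =
   gmean e N (fun g => rho g * (F' g - s^-1 * (f (T s g) - f g))) +
   gmean e N (Phi t) + gmean e N (fun g => (F g - f (T t g)) * dual rho g).
  have -> : gmean e N (Phi t) = gmean e N (fun g => f (T t g) * dual rho g) +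
     s^-1 * (psi s - psi 0).
    rewrite psiE mulrC mulfK ?gt_eqF // addrC /Phi.
    exact: gmeanD.
  rewrite /psi -gmeanB -gmeanZ -!gmeanD; congr (gmean e N _); apply: funext => g.
  by rewrite (flow0 TD); ring.
have B1 : `|gmean e N (fun g => rho g * (F' g - s^-1 * (f (T s g) - f g)))|
    <= M * (3 * eta).
  apply: gmean_norm_le => // g Kg; rewrite normrM ler_pM //; first exact: HM1'.
  have h1 := Hs g Kg.
  have ss : 0 <= s <= s by rewrite lexx ltW.
  have h2 := Hf' s g ss Kg.
  have s00 : 0 <= (0 : R) <= s by rewrite lexx ltW.
  have h3 := Hf' 0 g s00 Kg; rewrite (flow0 TD) in h3.
  have -> : F' g - s^-1 * (f (T s g) - f g) =
    - (s^-1 * (F (T s g) - F g) - F' g) - s^-1 * (f (T s g) - F (T s g)) +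
    s^-1 * (f g - F g) by ring.
  have -> : 3 * eta = eta + eta + eta by ring.
  apply: (le_trans (ler_normD _ _)); apply: lerD.
    apply: (le_trans (ler_normB _ _)); apply: lerD; first by rewrite normrN.
    by rewrite normrM normfV (ger0_norm (ltW s0)) ler_pdivrMl // mulrC.
  by rewrite normrM normfV (ger0_norm (ltW s0)) ler_pdivrMl // mulrC.
have B2 : `|gmean e N (fun g => (F g - f (T t g)) * dual rho g)| <= (2 * eta) * M.
  apply: gmean_norm_le => // g Kg; rewrite normrM ler_pM //; last exact: HM2'.
  rewrite distrC -(subrKA (F (T t g))) (le_trans (ler_normD _ _)) //.
  have -> : 2 * eta = eta + eta by ring.
  rewrite lerD //; last exact: Ht.
  by apply: (le_trans (Hf' _ _ ts Kg)); rewrite ler_piMr // ltW.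
apply: (@le_trans _ _ (M * (3 * eta) + eta + 2 * eta * M)).
  apply: (le_trans (ler_normD _ _)); apply: lerD => //.
  by apply: (le_trans (ler_normD _ _)); apply: lerD => //; exact: HN0.
have -> : M * (3 * eta) + eta + 2 * eta * M = eta * (1 + 5 * M) by ring.
by rewrite /eta divfK // gt_eqF // ltr_pwDl // mulr_ge0.
Unshelve. all: by end_near. Qed.

End Flow.
End Transport.

(** * Shrinking bump functions *)

Lemma differentiable_lip (R : realType) (V W : normedModType R) (f : V -> W) (x : V) :
  differentiable f x -> exists2 L : R, 0 <= L &
    \forall h \near (0 : V), `|f (h + x) - f x| <= L * `|h|.
Proof.
move=> df; have [k k0 Hk] := linear_lipschitz (diff_continuous df).
have := diff_locally df => /eqaddoP/(_ 1 ltr01) H.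
exists (1 + k); first by rewrite addr_ge0 // ltW.
near=> h.
have -> : f (h + x) - f x = (f (h + x) - (f x + 'd f x h)) + 'd f x h.
  by rewrite opprD addrA subrK.
rewrite (le_trans (ler_normD _ _)) // mulrDl lerD //.
by near: h; exact: H.
Unshelve. all: by end_near. Qed.

Section Bump2.
Variables (R : realType) (n : nat) (p : 'rV[R]_n).

Lemma flat0_le1 (t : R) : flat 0 t <= 1.
Proof.
rewrite /flat; case: ifP => [t0|_]; last exact: ler01.
by rewrite expr0 mul1r expR_le1 oppr_le0 invr_ge0 ltW.
Qed.

Lemma flat0_ge (t : R) : 2^-1 <= t -> expR (- 2) <= flat 0 t.
Proof.
move=> t2; have t0 : 0 < t by apply: lt_le_trans t2; rewrite invr_gt0.
rewrite /flat t0 expr0 mul1r ler_expR lerN2 invf_ple ?posrE //.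
Qed.

Lemma derive_sqdist (z : 'rV[R]_n) i :
  is_derive z 'e_i (sqdist p) (2 * (z 0 i - p 0 i)).
Proof.
pose df j := (i == j)%:R * (z 0 j - p 0 j) + (i == j)%:R * (z 0 j - p 0 j).
have H j : is_derive z 'e_i (fun z : 'rV[R]_n => (z 0 j - p 0 j) ^+ 2) (df j).
  have h1 : is_derive z 'e_i (fun z : 'rV[R]_n => z 0 j - p 0 j) (i == j)%:R.
    have := is_deriveB (is_derive_coord i j z) (is_derive_cst (p 0 j) z 'e_i).
    by rewrite subr0.
  have h2 := is_deriveM h1 h1.
  apply: (is_derive_eq h2); rewrite /df ![_ *: _]mulrC //.
have := is_derive_sumf (index_enum 'I_n) H.
have -> : \sum_j df j = 2 * (z 0 i - p 0 i).
  rewrite (bigD1 i) //= big1 => [|j ji].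
    by rewrite /df eqxx !mul1r addr0; ring.
  by rewrite /df eq_sym (negbTE ji) !mul0r addr0.
exact.
Qed.

(** The derivative of [flat 0] is [flat 2], at most [4! = 24] on arguments up to 1; the inner
    derivative is at most [2 e / (e / 2)^2 = 8 / e]; and [24 * 8 = 192]. *)
Lemma derive_bump (e : R) (z : 'rV[R]_n) i : 0 < e -> cube p e z ->
  `|'D_'e_i (bumpf p (e / 2)) z| <= 192 / e.
Proof.
move=> e0 Kz; set s := e / 2; have s0 : 0 < s by rewrite divr_gt0.
have h1 : is_derive z 'e_i (fun z => 1 - sqdist p z / s ^+ 2)
    (- ((s ^+ 2)^-1 * (2 * (z 0 i - p 0 i)))).
  have H := is_deriveB (is_derive_cst (1 : R) z 'e_i)
    (is_deriveZ (s ^+ 2)^-1 (derive_sqdist z i)).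
  rewrite sub0r in H.
  have -> : (fun z => 1 - sqdist p z / s ^+ 2) =
      (fun z => 1 - (s ^+ 2)^-1 * sqdist p z).
    by apply: funext => z'; rewrite mulrC.
  exact: H.
have [d1 d2] := h1.
have [_ ->] := is_derive_flat_comp 0 d1.
rewrite d2 mul0r subr0 normrM.
have -> : 192 / e = 24 * (8 / e).
  by rewrite mulrA -natrM.
rewrite ler_pM //.
  rewrite ger0_norm ?flat_ge0 //.
  have t1 : 1 - sqdist p z / s ^+ 2 <= 1.
    by rewrite gerBl divr_ge0 ?exprn_ge0 ?(ltW s0) // sumr_ge0 // => j _; exact: sqr_ge0.
  set t := 1 - _ in t1 *; have [t0|t0] := leP t 0; first by rewrite flat_le0.
  apply: (le_trans (flat_sq _ _)); rewrite ger_pMr // expr_le1 //.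
  exact: ltW.
rewrite normrN normrM gtr0_norm ?invr_gt0 ?exprn_gt0 // normrM (ger0_norm (ler0n _ 2)).
apply: (@le_trans _ _ ((s ^+ 2)^-1 * (2 * e))).
  by rewrite ler_pM2l ?invr_gt0 ?exprn_gt0 // ler_pM2l //; exact: Kz.
rewrite le_eqVlt; apply/orP; left; apply/eqP; rewrite /s; field.
by rewrite gt_eqF.
Qed.

End Bump2.

Section Core.
Variables (R : realType) (n : nat) (G : lieGroupType R n).
Variables (c : chart R n G) (ac : atlas c) (c1 : cdom c 1%g) (r : R).
Local Notation p := (cmap c 1%g).
Hypotheses (r0 : 0 < r) (pr : cube p r `<=` cimg c).

Local Notation r1 := (r / n.+1%:R).
Local Notation gmean := (gmean c p).
Local Notation test := (test c p).
Local Notation dual := (dual c p r).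
Local Notation box := (box c p).

Lemma near_box (F : G -> R) (eta : R) : 0 < eta -> continuous F ->
  exists2 e, 0 < e & forall e' g, 0 < e' -> e' <= e -> box e' g ->
    `|F g - F 1%g| <= eta.
Proof.
move=> eta0 cF.
have C : {for p, continuous (fun z => F (cinv c z))}.
  apply: continuous_comp; last exact: cF.
  by apply: cinv_continuous => //; exact: cimg_cmap.
have /cvgrPdist_le/(_ _ eta0) := C; rewrite cmapK // => /cube_in[e e0 He].
exists e => // e' g e'0 ee [z Kz <-]; rewrite distrC; apply: He.
exact: cube_sub Kz.
Qed.

Definition rho (e : R) : G -> R := ext c (bumpf p (e / 2)).

Lemma half_le (e : R) : 0 < e -> e < r1 -> e / 2 <= r.
Proof.
move=> e0 er; apply: (@le_trans _ _ e).
  by rewrite ler_pdivrMr // ler_peMr ?ler1n // ltW.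
by apply: (le_trans (ltW er)); exact: r1_le.
Qed.

Lemma test_rho e : 0 < e -> e < r1 -> test e (rho e).
Proof.
move=> e0 er; have s0 : 0 < e / 2 by rewrite divr_gt0.
have sub : cube p (e / 2) `<=` cimg c.
  by move=> z /(cube_sub (half_le e0 er))/pr.
split.
  apply: (ext_smooth ac sub) => [z|k]; first exact: bump_out.
  by apply: bump_smooth; exact: cimg_open.
move=> g; rewrite /rho /ext; case: asboolP => [cg bg|_]; last by rewrite eqxx.
split => //; apply: contrapT => /bump_out nK.
by rewrite nK // eqxx in bg.
Qed.

Lemma rho_le1 e g : 0 <= rho e g <= 1.
Proof.
rewrite /rho /ext; case: ifP => _; last by rewrite lexx ler01.
by rewrite bump_ge0 flat0_le1.
Qed.

(** On the cube of radius [e / (4 (n + 1))] the squared distance is at most half of [(e / 2)^2], so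
    the bump is at least [exp(-2)] there. By scaling, the resulting bound does not depend on [e]. *)
Lemma gmean_rho e : 0 < e -> e < r1 -> forall N0, exists2 N, (N0 <= N)%N &
  expR (- 2) / (2 * (4 * n.+1)%:R) ^+ n <= gmean e N (rho e).
Proof.
move=> e0 er; apply: (mean_ge e0 _ _ _ (expR_ge0 (- 2))) => [|z|z Kz].
- by rewrite muln_gt0.
- by have /andP[] := rho_le1 e (cinv c z).
have M0 : 0 < (4 * n.+1)%:R :> R by rewrite ltr0n.
have Kze : cube p e z.
  by apply: cube_sub Kz; rewrite ler_pdivrMr // ler_peMr ?ler1n // ltW.
rewrite /rho ext_cinv //; last exact: (cube_e_sub r0 pr er).
apply: flat0_ge; rewrite lerBrDr -lerBrDl.
have -> : 1 - 2^-1 = 2^-1 :> R by field.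
have s2 : 0 < (e / 2) ^+ 2 by rewrite exprn_gt0 // divr_gt0.
rewrite ler_pdivrMr //; apply: (le_trans (sqdist_cube Kz)).
rewrite natrM !exprMn -[n.+1%:R]natr1.
have e2 : 0 < e ^+ 2 by rewrite exprn_gt0.
rewrite mulrCA [leRHS]mulrCA ler_pM2l // exprVn ler_pdivrMr ?exprn_gt0 //.
have -> : 2^-1 * 2^-1 ^+ 2 * (4 * (n%:R + 1)) ^+ 2 = 2 * (n%:R + 1) ^+ 2 :> R.
  by field.
have := ler0n R n; nra.
Qed.

Section TwoFlows.
Variables (T T' : R -> G -> G) (D D' : (G -> R) -> G -> R).
Hypotheses (TD : flow T D) (TD' : flow T' D').
Hypothesis DD' : forall f, smooth f -> D f 1%g = D' f 1%g.

(* The fields agree at 1, hence differ by O(e) on the cube of radius e, while the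
   derivatives of the bump function are O(1 / e). *)
Lemma dual_diff_bound : exists2 e0 : R, 0 < e0 & exists2 M : R, 0 <= M &
  forall e, 0 < e -> e < e0 -> e < r1 -> forall g, box e g ->
    `|dual D (rho e) g - dual D' (rho e) g| <= M.
Proof.
have r10 : 0 < r1 by exact: r1_gt0.
(* The divergences are bounded once on this fixed box, so that [M] does not depend on [e]. *)
have er1 : r1 / 2 < r1 by rewrite ltr_pdivrMr // ltr_pMr // ltr1n.
have [Md Md0 HMd] := continuous_box_bounded ac r0 pr er1 (smooth_continuous
  (smoothB (divg_smooth ac r0 pr TD) (divg_smooth ac r0 pr TD'))).
have HL i : exists L : R, 0 <= L /\ \forall h \near (0 : 'rV[R]_n),
    `|vcomp c p r D i (cinv c (h + p)) - vcomp c p r D' i (cinv c (h + p))|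
      <= L * `|h|.
  have sW := smoothB (vcomp_smooth ac r0 pr TD i) (vcomp_smooth ac r0 pr TD' i).
  have [d1 _] := Ck_on_diff (cimg_open ac) (sW c ac 1%N) (cimg_cmap c1).
  have [L L0 HL] := differentiable_lip d1; exists L; split => //.
  apply: filterS HL => h /=.
  rewrite cmapK // [X in _ - X](_ : _ = 0) ?subr0 //.
  by apply/eqP; rewrite subr_eq0; apply/eqP/DD'; exact: coordf_smooth.
have /choice[L HL'] := HL.
pose Ls := \sum_i L i.
have L0 i : 0 <= L i by have [] := HL' i.
have N : nbhs (0 : 'rV[R]_n) [set h | forall i,
    `|vcomp c p r D i (cinv c (h + p)) - vcomp c p r D' i (cinv c (h + p))|
      <= L i * `|h|].
  near=> h => i; move: i; near: h; apply: filter_forall => i.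
  by have [] := HL' i.
have [e0 e00 He0] := cube_in N.
exists (Num.min e0 (r1 / 2)); first by rewrite lt_min e00 divr_gt0.
exists (Ls * 192 + Md); first by rewrite addr_ge0 // mulr_ge0 // sumr_ge0.
move=> e epos; rewrite lt_min => /andP[ee0 er12] er g [z Kz <-].
have Kr1 : cube p r1 z by apply: cube_sub Kz; exact: ltW.
have zr i : `|z 0 i - p 0 i| < r1 by apply: le_lt_trans er; exact: Kz.
have Kr : cube p r z by apply: cube_sub Kr1; exact: r1_le.
have cz := pr Kr.
have [srho _] := test_rho epos er.
rewrite /dual (flow_deriv_coord ac r0 pr TD) // (flow_deriv_coord ac r0 pr TD') //.
set S := \sum_i _; set S' := \sum_i _.
have -> : S + divg c p r D (cinv c z) * rho e (cinv c z) -
    (S' + divg c p r D' (cinv c z) * rho e (cinv c z)) =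
  (S - S') + (divg c p r D (cinv c z) - divg c p r D' (cinv c z)) * rho e (cinv c z).
  by ring.
rewrite (le_trans (ler_normD _ _)) // lerD //; last first.
  have /andP[h0 h1] := rho_le1 e (cinv c z).
  rewrite normrM (ger0_norm h0) -[leRHS]mulr1 ler_pM //.
  by apply: HMd; exists z => //; apply: cube_sub Kz; exact: ltW.
rewrite /S /S' -sumrB /Ls mulr_suml (le_trans (ler_norm_sum _ _ _)) //.
apply: ler_sum => i _; rewrite -mulrBl normrM.
have -> : 'D_'e_i (fun z => rho e (cinv c z)) z = 'D_'e_i (bumpf p (e / 2)) z.
  apply: near_eq_derive.
  move: (open_near (cimg_open ac) cz); apply: filterS => z' cz'.
  by rewrite /rho ext_cinv.
apply: (@le_trans _ _ (L i * e * (192 / e))).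
  rewrite ler_pM //; last exact: derive_bump.
  have K0 : cube 0 e0 (z - p).
    by move=> j; rewrite !mxE subr0; apply: (le_trans (Kz j)); exact: ltW.
  have := He0 _ K0 i; rewrite subrK => /le_trans; apply.
  by rewrite ler_wpM2l //; apply/cube_norm => //; exact: ltW.
by rewrite mulrA mulrAC mulfK // gt_eqF.
Unshelve. all: by end_near. Qed.

End TwoFlows.
End Core.

(** * The weak commutation relation *)

(** Uniform in the point, as the integration by parts along a flow requires; it uses positive times
    only. *)
Definition unif_deriv (R : realType) (T : Type) (S : R -> T -> T) (F F' : T -> R) :=
  forall eta : R, 0 < eta -> \forall s \near 0^'+, forall g,
    `|s^-1 * (F (S s g) - F g) - F' g| <= eta.

Lemma cvg0D (R : realType) (u v : nat -> R) : u @ \oo --> 0 -> v @ \oo --> 0 ->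
  (fun N => u N + v N) @ \oo --> 0.
Proof.
move=> hu hv; have H : (fun N => u N + v N) @ \oo --> (0 + 0 : R) by exact: cvgD.
by rewrite addr0 in H.
Qed.

Lemma cvg0B (R : realType) (u v : nat -> R) : u @ \oo --> 0 -> v @ \oo --> 0 ->
  (fun N => u N - v N) @ \oo --> 0.
Proof.
move=> hu hv; have H : (fun N => u N - v N) @ \oo --> (0 - 0 : R) by exact: cvgB.
by rewrite subr0 in H.
Qed.

Lemma cvg0Z (R : realType) (x : R) (u : nat -> R) : u @ \oo --> 0 ->
  (fun N => x * u N) @ \oo --> 0.
Proof.
move=> hu; have H : (fun N => x * u N) @ \oo --> (x * 0 : R).
  by apply: cvgM => //; exact: cvg_cst.
by rewrite mulr0 in H.
Qed.

Lemma cvg_lin0 (R : realType) (x y : R) (b1 b2 b3 b4 b5 b6 b7 b8 b9 b10 : nat -> R) :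
  b1 @ \oo --> 0 -> b2 @ \oo --> 0 -> b3 @ \oo --> 0 -> b4 @ \oo --> 0 ->
  b5 @ \oo --> 0 -> b6 @ \oo --> 0 -> b7 @ \oo --> 0 -> b8 @ \oo --> 0 ->
  b9 @ \oo --> 0 -> b10 @ \oo --> 0 ->
  (fun N => b1 N - b2 N + b3 N + b4 N - b5 N - b6 N
    + x * (b7 N - b8 N) - y * (b9 N - b10 N)) @ \oo --> 0.
Proof.
move=> h1 h2 h3 h4 h5 h6 h7 h8 h9 h10.
have k1 := cvg0Z x (cvg0B h7 h8); have k2 := cvg0Z y (cvg0B h9 h10).
exact: (cvg0B (cvg0D (cvg0B (cvg0B (cvg0D (cvg0D (cvg0B h1 h2) h3) h4) h5) h6) k1) k2).
Qed.

Section CoreIdentity.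
Variables (R : realType) (n : nat) (G : lieGroupType R n).
Variables (TX TY TC TX' TY' : R -> G -> G).
Variables (X Y C X' Y' : (G -> R) -> G -> R).
Hypotheses (fX : flow TX X) (fY : flow TY Y) (fC : flow TC C).
Hypotheses (fX' : flow TX' X') (fY' : flow TY' Y').
Hypothesis CE : forall f g, smooth f -> C f g = Y (X f) g - X (Y f) g.
Hypothesis XX' : forall f, smooth f -> X f 1%g = X' f 1%g.
Hypothesis YY' : forall f, smooth f -> Y f 1%g = Y' f 1%g.
(** In the application [F g] is [Re<u, pi(g)x>]; [FA], [FB], [FC] have [Au], [Bu], [Cu] in place of
    [u]; [PAB g] is [Re<Au, pi(g)Bx>] and [PBA g] is [Re<Bu, pi(g)Ax>]. The unprimed flows are left
    translations, the primed ones right translations. *)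
Variables (F FA FB FC PAB PBA : G -> R).
Hypotheses (cF : continuous F) (cA : continuous FA) (cB : continuous FB).
Hypotheses (cC : continuous FC) (cAB : continuous PAB) (cBA : continuous PBA).
Hypothesis dX : unif_deriv TX F (fun g => - FA g).
Hypothesis dY : unif_deriv TY F (fun g => - FB g).
Hypothesis dC : unif_deriv TC F (fun g => - FC g).
Hypothesis dX' : unif_deriv TX' FB PBA.
Hypothesis dY' : unif_deriv TY' FA PAB.

Section InChart.
Variables (c : chart R n G) (ac : atlas c) (c1 : cdom c 1%g) (r : R).
Local Notation p := (cmap c 1%g).
Hypotheses (r0 : 0 < r) (pr : cube p r `<=` cimg c).

Local Notation r1 := (r / n.+1%:R).
Local Notation gmean := (gmean c p).
Local Notation test := (test c p).
Local Notation dual := (dual c p r).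
Local Notation box := (box c p).
Local Notation dv := (divg c p r).

Let q : G -> R := fun g => dv C g + X (dv Y) g - Y (dv X) g.

(** By [CE] the second order terms cancel against [C f], and the mixed first order terms cancel by
    symmetry; only multiplication by [q] survives. *)
Lemma dual_commutator f g : smooth f ->
  dual C f g + dual X (dual Y f) g - dual Y (dual X f) g = q g * f g.
Proof.
move=> sf; have sdX := divg_smooth ac r0 pr fX; have sdY := divg_smooth ac r0 pr fY.
have sX := flow_deriv_smooth fX sf; have sY := flow_deriv_smooth fY sf.
rewrite /dual CE //.
rewrite (flow_derivD fX _ sY (smoothM sdY sf)) (flow_derivM fX _ sdY sf).
rewrite (flow_derivD fY _ sX (smoothM sdX sf)) (flow_derivM fY _ sdX sf).
by rewrite /q; ring.
Qed.

Variable e : R.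
Hypotheses (e0 : 0 < e) (er : e < r1).

Let er2 : e / 2 <= r. Proof. exact: (half_le r0 e0 er). Qed.

(* In fact q = 0 on the cube, but deducing it weakly, from the divergence theorem
   applied to each term of dual_commutator, avoids the symmetry of second
   derivatives. *)
Lemma commutator_weak f : test e f ->
  gmean e N (fun g => F g * (q g * f g)) @[N --> \oo] --> 0.
Proof.
move=> tf; have [sf _] := tf.
have tY := test_dual ac r0 pr fY er2 tf; have tX := test_dual ac r0 pr fX er2 tf.
have sq : smooth q.
  apply: smoothB; last exact: (flow_deriv_smooth fY (divg_smooth ac r0 pr fX)).
  apply: smoothD; first exact: (divg_smooth ac r0 pr fC).
  exact: (flow_deriv_smooth fX (divg_smooth ac r0 pr fY)).
have H0 h : test e h -> gmean e N (fun g => q g * h g) @[N --> \oo] --> 0.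
  move=> th; have [sh _] := th.
  have tY' := test_dual ac r0 pr fY er2 th; have tX' := test_dual ac r0 pr fX er2 th.
  have H1 := gmean_dual ac r0 pr fC e0 er th.
  have H2 := gmean_dual ac r0 pr fX e0 er tY'.
  have H3 := gmean_dual ac r0 pr fY e0 er tX'.
  have -> : (fun N => gmean e N (fun g => q g * h g)) = (fun N =>
    gmean e N (dual C h) + gmean e N (dual X (dual Y h)) -
    gmean e N (dual Y (dual X h))).
    apply: funext => N; rewrite -gmeanD -gmeanB; congr (gmean e N _).
    by apply: funext => g; rewrite dual_commutator.
  have H : gmean e N (dual C h) + gmean e N (dual X (dual Y h)) -
    gmean e N (dual Y (dual X h)) @[N --> \oo] --> (0 + 0 - 0 : R).
    exact: (cvgB (cvgD H1 H2) H3).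
  by rewrite addr0 subr0 in H.
have [M M0 HM] := continuous_box_bounded ac r0 pr er (smooth_continuous (smoothM sq sf)).
apply/cvgr0Pnorm_le => eta eta0.
(* [F] is merely continuous, so [f * F] is not a test function; [F] is replaced by a smooth [h] this
   close to it. *)
have d0 : 0 < eta / 2 / (1 + M) by rewrite !divr_gt0 // ltr_pwDl.
have [h sh Hh] := smooth_approx (box_compact ac r0 pr er) cF d0.
have th := testM tf sh.
have e2 : 0 < eta / 2 by rewrite divr_gt0.
have /cvgr0Pnorm_le/(_ _ e2) Hn := H0 _ th.
apply: filterS Hn => N HN.
have -> : gmean e N (fun g => F g * (q g * f g)) =
   gmean e N (fun g => q g * (f g * h g)) +
   gmean e N (fun g => (F g - h g) * (q g * f g)).
  by rewrite -gmeanD; congr (gmean e N _); apply: funext => g; ring.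
rewrite (le_trans (ler_normD _ _)) // (splitr eta) lerD //.
apply: gmean_norm_le => // g Kg; rewrite normrM distrC.
apply: (@le_trans _ _ (eta / 2 / (1 + M) * M)).
  by rewrite ler_pM //; [exact: Hh|exact: HM].
rewrite -mulrA; apply: ler_piMr; first exact: ltW.
rewrite ler_pdivrMl ?ltr_pwDl // mulr1.
by rewrite lerDr.
Qed.

Lemma gmean_lin N (x y : R) b1 b2 b3 b4 b5 b6 b7 b8 b9 b10 :
  gmean e N (fun g => b1 g - b2 g + b3 g + b4 g - b5 g - b6 g
    + x * (b7 g - b8 g) - y * (b9 g - b10 g)) =
  gmean e N b1 - gmean e N b2 + gmean e N b3 + gmean e N b4 - gmean e N b5
    - gmean e N b6 + x * (gmean e N b7 - gmean e N b8)
    - y * (gmean e N b9 - gmean e N b10).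
Proof. by rewrite !(gmeanB, gmeanD, gmeanZ). Qed.

Let S g := PAB g - PBA g - FC g.

(** Five integrations by parts: three move [X], [Y], [C] from [F] to the dual images of [rho], two
    use the left-invariant fields on [FA] and [FB]. The terms with [F] combine to [q] by
    [dual_commutator] and are removed by [commutator_weak]. The constants [FA 1] and [FB 1] come at
    no cost, dual functions having mean tending to 0. *)
Lemma core_mean : gmean e N (fun g => rho c e g * S g
    - (FA g - FA 1%g) * (dual Y (rho c e) g - dual Y' (rho c e) g)
    + (FB g - FB 1%g) * (dual X (rho c e) g - dual X' (rho c e) g))
  @[N --> \oo] --> 0.
Proof.
set f := rho c e; have tf : test e f by exact: (test_rho ac r0 pr).
have [sf _] := tf.
have tY := test_dual ac r0 pr fY er2 tf; have tX := test_dual ac r0 pr fX er2 tf.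
have box_deriv T Phi Phi' : unif_deriv T Phi Phi' ->
  forall eta : R, 0 < eta -> \forall s \near 0^'+, forall g, box e g ->
     `|s^-1 * (Phi (T s g) - Phi g) - Phi' g| <= eta.
  by move=> H eta eta0; apply: filterS (H _ eta0) => s Hs g _; exact: Hs.
have t1 := transport ac r0 pr fX e0 er cF (box_deriv _ _ _ dX) tY.
have t2 := transport ac r0 pr fY e0 er cF (box_deriv _ _ _ dY) tX.
have t3 := transport ac r0 pr fC e0 er cF (box_deriv _ _ _ dC) tf.
have t4 := transport ac r0 pr fY' e0 er cA (box_deriv _ _ _ dY') tf.
have t5 := transport ac r0 pr fX' e0 er cB (box_deriv _ _ _ dX') tf.
have t6 := commutator_weak tf.
have u1 := gmean_dual ac r0 pr fY e0 er tf.
have u2 := gmean_dual ac r0 pr fY' e0 er tf.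
have u3 := gmean_dual ac r0 pr fX e0 er tf.
have u4 := gmean_dual ac r0 pr fX' e0 er tf.
pose a1 N := gmean e N (fun g => dual Y f g * - FA g + F g * dual X (dual Y f) g).
pose a2 N := gmean e N (fun g => dual X f g * - FB g + F g * dual Y (dual X f) g).
pose a3 N := gmean e N (fun g => f g * - FC g + F g * dual C f g).
pose a4 N := gmean e N (fun g => f g * PAB g + FA g * dual Y' f g).
pose a5 N := gmean e N (fun g => f g * PBA g + FB g * dual X' f g).
pose a6 N := gmean e N (fun g => F g * (q g * f g)).
have E : (fun N => gmean e N (fun g => f g * S g
    - (FA g - FA 1%g) * (dual Y f g - dual Y' f g)
    + (FB g - FB 1%g) * (dual X f g - dual X' f g))) =
  (fun N => a1 N - a2 N + a3 N + a4 N - a5 N - a6 N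
     + FA 1%g * (gmean e N (dual Y f) - gmean e N (dual Y' f))
     - FB 1%g * (gmean e N (dual X f) - gmean e N (dual X' f))).
  apply: funext => N.
  rewrite /a1 /a2 /a3 /a4 /a5 /a6 -gmean_lin.
  congr (gmean e N _); apply: funext => g.
  rewrite -(dual_commutator g sf) /S.
  move: (dual C f g) (dual X (dual Y f) g) (dual Y (dual X f) g) (dual X f g)
    (dual X' f g) (dual Y f g) (dual Y' f g) (F g) (FA g) (FB g) (FC g) (PAB g)
    (PBA g) (FA 1%g) (FB 1%g) (f g) => *.
  ring.
rewrite E.
exact: (@cvg_lin0 R (FA 1%g) (FB 1%g) a1 a2 a3 a4 a5 a6 _ _ _ _
  t1 t2 t3 t4 t5 t6 u1 u2 u3 u4).
Qed.

End InChart.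

Lemma core_identity : FC 1%g = PAB 1%g - PBA 1%g.
Proof.
have [c ac c1] := atlas_cover (1%g : G).
have [r r0 pr] : exists2 r : R, 0 < r & cube (cmap c 1%g) r `<=` cimg c.
  apply: cube_in; exact: (open_near (cimg_open ac) (cimg_cmap c1)).
pose S g := PAB g - PBA g - FC g.
have cS : continuous S.
  by move=> g; exact: (continuousB (continuousB (@cAB g) (@cBA g)) (@cC g)).
suff : S 1%g = 0 by rewrite /S => /eqP; rewrite subr_eq0 => /eqP.
have [ex ex0 [MX MX0 HX]] := dual_diff_bound ac c1 r0 pr fX fX' XX'.
have [ey ey0 [MY MY0 HY]] := dual_diff_bound ac c1 r0 pr fY fY' YY'.
(* The lower bound of [gmean_rho] for the mass of the bump. *)
set k := expR (- 2) / (2 * (4 * n.+1)%:R) ^+ n : R.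
have k0 : 0 < k by rewrite divr_gt0 ?expR_gt0 // exprn_gt0 // mulr_gt0 // ltr0n.
have main (d : R) : 0 < d -> `|S 1%g| * k <= d * (2 + MX + MY).
  move=> d0.
  have [eS eS0 HS] := near_box ac c1 d0 cS.
  have [eA eA0 HA] := near_box ac c1 d0 cA.
  have [eB eB0 HB] := near_box ac c1 d0 cB.
  have r10 := r1_gt0 n r0.
  pose e := Num.min (Num.min (Num.min eS eA) (Num.min eB ex))
    (Num.min ey (r / n.+1%:R)) / 2.
  have m0 : 0 < Num.min (Num.min (Num.min eS eA) (Num.min eB ex))
    (Num.min ey (r / n.+1%:R)) by rewrite !lt_min eS0 eA0 eB0 ex0 ey0.
  have e0 : 0 < e by rewrite divr_gt0.
  have : e < Num.min (Num.min (Num.min eS eA) (Num.min eB ex))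
    (Num.min ey (r / n.+1%:R)) by rewrite ltr_pdivrMr // ltr_pMr // ltr1n.
  rewrite !lt_min => /andP[/andP[/andP[eeS eeA] /andP[eeB eex]] /andP[eey er]].
  have /cvgr0Pnorm_le/(_ _ d0) := core_mean ac r0 pr e0 er.
  (* The limit holds for all large [N] and the lower bound for arbitrarily large ones, so a single
     [N] serves both. *)
  move=> [N0 _ HN0]; have [N N0N Hk] := gmean_rho ac r0 pr e0 er N0.
  have := HN0 N N0N => /=; set m := gmean c _ e N _ => Hm.
  have E : S 1%g * gmean c (cmap c 1%g) e N (rho c e) = m
    - gmean c (cmap c 1%g) e N (fun g => rho c e g * (S g - S 1%g)
     - (FA g - FA 1%g) * (dual c (cmap c 1%g) r Y (rho c e) g -
          dual c (cmap c 1%g) r Y' (rho c e) g)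
     + (FB g - FB 1%g) * (dual c (cmap c 1%g) r X (rho c e) g -
          dual c (cmap c 1%g) r X' (rho c e) g)).
    rewrite -gmeanZ -gmeanB; congr (gmean c _ e N _); apply: funext => g.
    by rewrite /S; ring.
  apply: (@le_trans _ _ `|S 1%g * gmean c (cmap c 1%g) e N (rho c e)|).
    by rewrite normrM ler_wpM2l // (le_trans Hk) // ler_norm.
  rewrite E (le_trans (ler_normB _ _)) //.
  have -> : d * (2 + MX + MY) = d + (d + d * MY + d * MX) by ring.
  rewrite lerD //; apply: gmean_norm_le => // g Kg.
  rewrite (le_trans (ler_normD _ _)) // lerD //.
    rewrite (le_trans (ler_normB _ _)) // lerD // normrM.
      have /andP[h0 h1] := rho_le1 c e g.
      rewrite (ger0_norm h0) -[leRHS]mul1r ler_pM //.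
      by apply: (HS e) => //; exact: ltW.
    by rewrite ler_pM //; [apply: (HA e) => //; exact: ltW|exact: (HY e)].
  by rewrite normrM ler_pM //; [apply: (HB e) => //; exact: ltW|exact: (HX e)].
have M0 : 0 < 2 + MX + MY by rewrite -addrA ltr_pwDl // addr_ge0.
apply/eqP; rewrite -normr_le0 leNgt; apply/negP => s0.
(* This [d] makes the right-hand side half of the left-hand side, contradicting positivity of the
   latter. *)
have := main (`|S 1%g| * k / 2 / (2 + MX + MY)).
rewrite !divr_gt0 ?mulr_gt0 // divfK ?gt_eqF // => /(_ isT).
by rewrite ler_pdivlMr // ger_pMr ?mulr_gt0 // leNgt ltr1n.
Qed.

End CoreIdentity.

(** * One-parameter subgroups and unitary representations *)

Section Flows.
Variables (R : realType) (n : nat) (G : lieGroupType R n).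
Variables (X : (G -> R) -> G -> R) (gamma : R -> G).
Hypothesis X_smooth : forall f, smooth f -> smooth (X f).
Hypothesis X_inv : right_invariant X.
Hypothesis gammaX : is_exp_curve X gamma.

Lemma exp_curveD s t : gamma (s + t) = (gamma s * gamma t)%g.
Proof. by have [_ H _] := gammaX; exact: H. Qed.

Lemma exp_curve0 : gamma 0 = 1%g.
Proof. by apply: (@mulgI _ (gamma 0)); rewrite -exp_curveD addr0 mulg1. Qed.

Lemma exp_curveN t : gamma (- t) = (gamma t)^-1%g.
Proof.
by apply: (@mulgI _ (gamma t)); rewrite -exp_curveD subrr exp_curve0 mulgV.
Qed.

Lemma exp_curve_deriv f g : smooth f ->
  is_derive (0 : R) (1 : R) (fun h => f (gamma h * g)%g) (X f g).
Proof.
move=> sf; have [_ _ H] := gammaX.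
have := H _ (smooth_mulr g sf); rewrite X_inv // mul1g; exact.
Qed.

Lemma mulg_curve_continuous :
  continuous (fun q : R * G => (gamma q.1 * q.2)%g) /\
  continuous (fun q : R * G => (q.2 * gamma q.1)%g).
Proof.
have [cg _ _] := gammaX.
have c1 : continuous (fun q : R * G => gamma q.1).
  by move=> q; apply: continuous_comp; [exact: cvg_fst|exact: cg].
have c2 : continuous (fun q : R * G => q.2) by move=> q; exact: cvg_snd.
split => q.
  apply: (@continuous_comp _ _ _ (fun q : R * G => (gamma q.1, q.2))
    (fun p : G * G => (p.1 * p.2)%g)); last exact: mulg_continuous.
  by apply: cvg_pair; [exact: c1|exact: c2].
apply: (@continuous_comp _ _ _ (fun q : R * G => (q.2, gamma q.1))
  (fun p : G * G => (p.1 * p.2)%g)); last exact: mulg_continuous.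
by apply: cvg_pair; [exact: c2|exact: c1].
Qed.

Lemma left_flow : flow (fun t g => (gamma t * g)%g) X.
Proof.
split.
- by move=> s t g; rewrite exp_curveD mulgA.
- by move=> g; rewrite exp_curve0 mul1g.
- exact: mulg_curve_continuous.1.
- by move=> s f; exact: smooth_mull.
- exact: X_smooth.
- by move=> f g; exact: exp_curve_deriv.
Qed.

(* The left-invariant field with the same value at 1 as X, obtained by inversion. *)
Definition left_field : (G -> R) -> G -> R :=
  fun f g => - X (fun h => f (h^-1)%g) (g^-1)%g.

(** Inversion exchanges the two sides: [g * gamma h] is the inverse of [gamma (- h) * g^-1]. The
    reversal of time accounts for the minus sign in [left_field]. *)
Lemma right_flow : flow (fun t g => (g * gamma t)%g) left_field.
Proof.
split.
- by move=> s t g; rewrite addrC exp_curveD mulgA.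
- by move=> g; rewrite exp_curve0 mulg1.
- exact: mulg_curve_continuous.2.
- by move=> s f; exact: smooth_mulr.
- move=> f sf; apply: smoothN.
  apply: (smooth_invg (f := X (fun h => f (h^-1)%g))).
  by apply: X_smooth; exact: smooth_invg.
- move=> f g sf.
  have H := exp_curve_deriv (g^-1)%g (smooth_invg sf).
  have H' : is_derive (- 0 : R) (1 : R) (fun h => f (gamma h * g^-1)^-1%g)
      (X (fun h => f (h^-1)%g) (g^-1)%g) by rewrite oppr0.
  have dN : is_derive (0 : R) (1 : R) (-%R : R -> R) (-1).
    exact: is_deriveN (is_derive_id (0 : R) (1 : R)).
  have := is_derive1_comp H' dN; rewrite mulrN1.
  rewrite (_ : _ \o _ = (fun h => f (g * gamma h)%g)) //.
  by apply: funext => h /=; rewrite exp_curveN invgF invgK.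
Qed.

Lemma left_field1 f : smooth f -> X f 1%g = left_field f 1%g.
Proof.
move=> sf; apply/esym/(flow_derivE right_flow sf).
have [_ _ H] := gammaX.
by under eq_fun do rewrite mul1g; exact: H.
Qed.

End Flows.

(** * The real inner product of a complex Hilbert space *)

Section Hilbert.
Variables (R : realType) (H : hilbertType R).
Implicit Types u v w : H.

(** Taking real parts allows real calculus for matrix coefficients; the modulus is recovered at the
    end by a phase. *)
Definition ip u v : R := complex.Re (inner u v).
Definition nm u : R := complex.Re `|u|.

Lemma nmE u : `|u| = real_complex R (nm u).
Proof. by rewrite /nm RRe_real // ger0_real. Qed.

Lemma nm_ge0 u : 0 <= nm u.
Proof. rewrite -lecR -nmE; exact: normr_ge0. Qed.

Lemma ipDl u v w : ip (u + v) w = ip u w + ip v w.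
Proof. by rewrite /ip linearDl raddfD. Qed.

Lemma ipNl u w : ip (- u) w = - ip u w.
Proof. by rewrite /ip linearNl raddfN. Qed.

Lemma ipBl u v w : ip (u - v) w = ip u w - ip v w.
Proof. by rewrite ipDl ipNl. Qed.

Lemma ipZl a u w : ip (real_complex R a *: u) w = a * ip u w.
Proof.
rewrite /ip linearZl_LR /=; case: (inner u w) => x y /=.
by rewrite mul0r subr0.
Qed.

Lemma ipC u v : ip u v = ip v u.
Proof.
rewrite /ip hermC /= expr0 mul1r.
by case: (inner v u).
Qed.

Lemma ipBr u v w : ip u (v - w) = ip u v - ip u w.
Proof. by rewrite ipC ipBl ipC [ip w u]ipC. Qed.

Lemma ipZr a u w : ip u (real_complex R a *: w) = a * ip u w.
Proof. by rewrite ipC ipZl ipC. Qed.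

Lemma ip_self u : ip u u = nm u ^+ 2.
Proof.
rewrite /ip -normE_inner nmE -rmorphXn //.
Qed.

(** Cauchy-Schwarz, by expanding the squared norm of [|v|^2 u - <u, v> v]. *)
Lemma ip_le u v : `|ip u v| <= nm u * nm v.
Proof.
rewrite -ler_sqr ?nnegrE ?mulr_ge0 ?nm_ge0 // real_normK ?num_real // exprMn.
have [v0|v0] := eqVneq (nm v ^+ 2) 0.
  have -> : v = 0.
    apply/eqP; rewrite -normr_eq0 nmE; move/eqP: v0.
    by rewrite expf_eq0 /= => /eqP ->.
  by rewrite ipC /ip linear0l expr0n /= mulr_ge0 // sqr_ge0.
have v2 : 0 < nm v ^+ 2 by rewrite lt_def v0 sqr_ge0.
have := sqr_ge0 (nm (real_complex R (nm v ^+ 2) *: u - real_complex R (ip u v) *: v)).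
have K (a i : R) : nm (real_complex R a *: u - real_complex R i *: v) ^+ 2 =
    a * (a * nm u ^+ 2) - i * (a * ip u v) - (a * (i * ip u v) - i * (i * nm v ^+ 2)).
  by rewrite -ip_self ipBl !ipBr !ipZl !ipZr !ip_self [ip v u]ipC; ring.
rewrite K.
set a := nm v ^+ 2 in v2 *; set b := nm u ^+ 2; set i := ip u v.
have -> : a * (a * b) - i * (a * i) - (a * (i * i) - i * (i * a)) =
   a * (b * a - i ^+ 2) by ring.
by rewrite pmulr_rge0 // subr_ge0.
Qed.

Lemma nmZ (a : R[i]) u : `|a| = 1 -> nm (a *: u) = nm u.
Proof. by move=> a1; rewrite /nm normrZ a1 mul1r. Qed.

End Hilbert.

Lemma near_punctured (R : realType) (P : R -> Prop) : (\forall t \near 0^', P t) ->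
  \forall s \near 0^'+, P s /\ P (- s).
Proof.
move=> /nbhs_ballP[d /= d0 Hd]; near=> s.
have s0 : 0 < s by near: s; exact: nbhs_right_gt.
have sd : s < d by near: s; exact: nbhs_right_lt.
split; apply: Hd; rewrite ?oppr_eq0 ?gt_eqF //.
  by rewrite -ball_normE /ball_ /= sub0r normrN gtr0_norm.
by rewrite -ball_normE /ball_ /= sub0r opprK gtr0_norm.
Unshelve. all: by end_near. Qed.

Section Representation.
Variables (R : realType) (n : nat) (G : lieGroupType R n) (H : hilbertType R).
Variables (pi : G -> {linear H -> H}).
Hypothesis hpi : unitary_representation pi.
Implicit Types (u v w x a b : H).

Lemma pi_mul g h u : pi (g * h)%g u = pi g (pi h u).
Proof. by case: hpi. Qed.

(** Multiplicativity makes [pi 1] idempotent, and unitarity makes it surjective. *)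
Lemma pi_one u : pi 1%g u = u.
Proof.
have [hu _ _] := hpi; have [_ /(_ u)[w <-]] := hu 1%g.
by rewrite -pi_mul mulg1.
Qed.

Lemma ip_pi g u v : ip (pi g u) (pi g v) = ip u v.
Proof. by have [hu _ _] := hpi; have [K _] := hu g; rewrite /ip K. Qed.

Lemma nm_pi g u : nm (pi g u) = nm u.
Proof.
by apply/eqP; rewrite -(@eqrXn2 _ 2) ?nm_ge0 // -!ip_self ip_pi.
Qed.

Lemma ip_pi_continuous v x : continuous (fun g => ip v (pi g x)).
Proof.
move=> g; have [_ _ /(_ x g) cpi] := hpi.
apply/cvgrPdist_le => eta eta0.
have d0 : 0 < eta / (1 + nm v) by rewrite divr_gt0 // ltr_pwDl // nm_ge0.
have dc : 0 < real_complex R (eta / (1 + nm v)) by rewrite ltcR.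
have /cvgrPdist_le/(_ _ dc) := cpi.
apply: filterS => h Hh; rewrite -ipBr (le_trans (ip_le _ _)) //.
have {}Hh : nm (pi g x - pi h x) <= eta / (1 + nm v).
  by rewrite -lecR -nmE.
apply: (@le_trans _ _ (nm v * (eta / (1 + nm v)))).
  by rewrite ler_wpM2l // nm_ge0.
rewrite mulrCA; apply: ler_piMr; first exact: ltW.
rewrite ler_pdivrMr ?ltr_pwDl ?nm_ge0 // mul1r.
by rewrite lerDr.
Qed.

(** [generates] hides the curve behind an existential; naming it lets one [gamma] serve for [u], for
    [x] and for the flow. *)
Definition curve_lim (gamma : R -> G) u a := forall eta : R, 0 < eta ->
  \forall t \near 0^', nm (real_complex R t^-1 *: (pi (gamma t) u - u) - a) <= eta.

Lemma generates_curve_lim X u a : generates pi X u a ->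
  exists2 gamma, is_exp_curve X gamma & curve_lim gamma u a.
Proof.
move=> [gamma hg lim]; exists gamma => // eta eta0.
have ec : 0 < real_complex R eta by rewrite ltcR.
have /cvgrPdist_le/(_ _ ec) := lim.
by apply: filterS => t; rewrite distrC nmE lecR.
Qed.

Lemma curve_limZ gamma u a (w : R[i]) : `|w| = 1 -> curve_lim gamma u a ->
  curve_lim gamma (w *: u) (w *: a).
Proof.
move=> w1 L eta eta0; apply: filterS (L _ eta0) => t.
rewrite linearZ /= -scalerBr scalerA mulrC -scalerA -scalerBr nmZ //.
Qed.

(** By unitarity a left translation of [g] by [gamma s] moves [u] by [gamma (- s)], hence the minus
    sign. The error is paired with [pi g x], whose norm does not depend on [g]. *)
Lemma unif_deriv_left X gamma u a x : is_exp_curve X gamma -> curve_lim gamma u a ->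
  unif_deriv (fun t g => (gamma t * g)%g) (fun g => ip u (pi g x))
    (fun g => - ip a (pi g x)).
Proof.
move=> hg L eta eta0.
have d0 : 0 < eta / (1 + nm x) by rewrite divr_gt0 // ltr_pwDl // nm_ge0.
apply: filterS (near_punctured (L _ d0)) => s [_ Hs] g.
have -> : ip u (pi (gamma s * g)%g x) = ip (pi (gamma (- s)) u) (pi g x).
  rewrite -(ip_pi (gamma s) (pi (gamma (- s)) u)) -!pi_mul.
  by rewrite -(exp_curveD hg) subrr (exp_curve0 hg) pi_one.
have -> : s^-1 * (ip (pi (gamma (- s)) u) (pi g x) - ip u (pi g x)) - - ip a (pi g x)
  = - ip (real_complex R (- s)^-1 *: (pi (gamma (- s)) u - u) - a) (pi g x).
  by rewrite ipBl ipZl ipBl invrN; ring.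
rewrite normrN (le_trans (ip_le _ _)) // nm_pi.
apply: (@le_trans _ _ (eta / (1 + nm x) * nm x)).
  by rewrite ler_wpM2r // nm_ge0.
rewrite -mulrA; apply: ler_piMr; first exact: ltW.
by rewrite ler_pdivrMl ?ltr_pwDl ?nm_ge0 // mulr1 lerDr.
Qed.

(** Here [gamma s] acts on [x] before [pi g], and the isometry [pi g] leaves the size of the error
    unchanged. *)
Lemma unif_deriv_right gamma v x b : curve_lim gamma x b ->
  unif_deriv (fun t g => (g * gamma t)%g) (fun g => ip v (pi g x))
    (fun g => ip v (pi g b)).
Proof.
move=> L eta eta0.
have d0 : 0 < eta / (1 + nm v) by rewrite divr_gt0 // ltr_pwDl // nm_ge0.
apply: filterS (near_punctured (L _ d0)) => s [Hs _] g.
have -> : s^-1 * (ip v (pi (g * gamma s)%g x) - ip v (pi g x)) - ip v (pi g b)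
  = ip v (pi g (real_complex R s^-1 *: (pi (gamma s) x - x) - b)).
  rewrite linearB linearZ linearB /= ipBr ipZr ipBr pi_mul //.
rewrite (le_trans (ip_le _ _)) // nm_pi.
apply: (@le_trans _ _ (nm v * (eta / (1 + nm v)))).
  by rewrite ler_wpM2l // nm_ge0.
rewrite mulrCA; apply: ler_piMr; first exact: ltW.
by rewrite ler_pdivrMr ?ltr_pwDl ?nm_ge0 // mul1r lerDr.
Qed.

Variables (X Y : (G -> R) -> G -> R).
Hypotheses (hX : lie_algebra X) (hY : lie_algebra Y).

Lemma lie_bracket_smooth f : smooth f -> smooth (lie_bracket X Y f).
Proof.
have [[sX _ _] _] := hX; have [[sY _ _] _] := hY.
by move=> sf; apply: smoothB; [apply/sY/sX|apply/sX/sY].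
Qed.

Lemma lie_bracket_inv : right_invariant (lie_bracket X Y).
Proof.
have [[sX _ _] iX] := hX; have [[sY _ _] iY] := hY.
move=> f a sf g; rewrite /lie_bracket.
have -> : X (fun p => f (p * a)%g) = fun p => X f (p * a)%g.
  by apply: funext => p; exact: iX.
have -> : Y (fun p => f (p * a)%g) = fun p => Y f (p * a)%g.
  by apply: funext => p; exact: iY.
by rewrite iY ?iX //; [exact: sY|exact: sX].
Qed.

(** A weak form of [[A, B] u = C u]: formally, skew-adjointness moves [A] and [B] from [x] to [u] on
    the right-hand side. It is [core_identity] for the matrix coefficients, evaluated at [g = 1]. *)
Lemma weak_commutator u x Au Bu Cu Ax Bx gX gY gC :
  is_exp_curve X gX -> is_exp_curve Y gY -> is_exp_curve (lie_bracket X Y) gC ->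
  curve_lim gX u Au -> curve_lim gY u Bu -> curve_lim gC u Cu ->
  curve_lim gX x Ax -> curve_lim gY x Bx ->
  ip Cu x = ip Au Bx - ip Bu Ax.
Proof.
move=> eX eY eC LXu LYu LCu LXx LYx.
have [[sX _ _] iX] := hX; have [[sY _ _] iY] := hY.
have fX := left_flow sX iX eX; have fY := left_flow sY iY eY.
have fC := left_flow lie_bracket_smooth lie_bracket_inv eC.
have fX' := right_flow sX iX eX; have fY' := right_flow sY iY eY.
have := @core_identity R n G _ _ _ _ _ _ _ _ _ _ fX fY fC fX' fY'
  (fun f g _ => erefl) (fun f => left_field1 sX iX eX (f := f))
  (fun f => left_field1 sY iY eY (f := f))
  (fun g => ip u (pi g x)) (fun g => ip Au (pi g x)) (fun g => ip Bu (pi g x))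
  (fun g => ip Cu (pi g x)) (fun g => ip Au (pi g Bx)) (fun g => ip Bu (pi g Ax))
  (@ip_pi_continuous u x) (@ip_pi_continuous Au x) (@ip_pi_continuous Bu x)
  (@ip_pi_continuous Cu x) (@ip_pi_continuous Au Bx) (@ip_pi_continuous Bu Ax)
  (unif_deriv_left x eX LXu) (unif_deriv_left x eY LYu) (unif_deriv_left x eC LCu)
  (unif_deriv_right Bu LXx) (unif_deriv_right Au LYx).
by rewrite !pi_one.
Qed.

End Representation.

Unset Implicit Arguments.

Theorem mainTheorem1 (R : realType) (n : nat) (G : lieGroupType R n)
    (H : hilbertType R) (pi : G -> {linear H -> H})
    (hpi : unitary_representation pi)
    (X Y : (G -> R) -> G -> R) (hX : lie_algebra X) (hY : lie_algebra Y) :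
  let A := gen pi X in
  let B := gen pi Y in
  let C := gen pi (lie_bracket X Y) in
  forall x : H,
    (dom_gen pi X `&` dom_gen pi Y `&` dom_gen pi (lie_bracket X Y)) x ->
    `|A x| * `|B x| >= 2^-1 * `|inner (C x) x|.
Proof.
move=> A B C x [[[a0 ha0] [b0 hb0]] [d0 hd0]].
(* Membership in the domain excludes the default value 0 of [xget], so [A x] is a genuine limit. *)
have /generates_curve_lim[gX eX LX] : generates pi X x (A x).
  by rewrite /A /gen; case: xgetP => [y _ //|/(_ a0)].
have /generates_curve_lim[gY eY LY] : generates pi Y x (B x).
  by rewrite /B /gen; case: xgetP => [y _ //|/(_ b0)].
have /generates_curve_lim[gC eC LC] : generates pi (lie_bracket X Y) x (C x).
  by rewrite /C /gen; case: xgetP => [y _ //|/(_ d0)].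
have [z0|z0] := eqVneq (inner (C x) x) 0.
  by rewrite z0 normr0 mulr0 mulr_ge0.
(* The phase with [w * z = |z|]; with [u = w x] the left-hand side of the identity becomes the full
   modulus. *)
set z := inner (C x) x in z0 *; pose w := `|z| / z.
have w1 : `|w| = 1.
  by rewrite /w normrM normfV normr_id divff // normr_eq0.
have := weak_commutator hpi hX hY eX eY eC (curve_limZ w1 LX) (curve_limZ w1 LY)
  (curve_limZ w1 LC) LX LY.
have -> : ip (w *: C x) x = complex.Re `|z|.
  by rewrite /ip linearZl_LR /= -/z /w divfK.
move=> E; have zE : `|z| = real_complex R (complex.Re `|z|).
  by rewrite RRe_real // ger0_real.
rewrite zE !nmE -[2^-1](_ : real_complex R 2^-1 = _); last by rewrite fmorphV rmorph_nat.
rewrite -!rmorphM lecR E ler_pdivrMl //.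
(* [E] writes [|z|] as a difference of two terms, each at most the product of the norms of [A x] and
   [B x]; this is the origin of the factor [1/2]. *)
apply: (le_trans (ler_norm _)); apply: (le_trans (ler_normB _ _)).
have := ip_le (w *: A x) (B x); have := ip_le (w *: B x) (A x).
rewrite !nmZ // => h1 h2.
by rewrite mulr_natl mulr2n lerD // mulrC.
Qed.
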